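(* $\mathsf{wScList}_{\mathbb{N}^{\mathbb{N}}}\equiv_{\mathrm{W}}\mathsf{PK}_{\mathbb{N}^{\mathbb{N}}}$.
   Context: A represented space is a set $X$ with a partial surjection $\delta_X:\subseteq\mathbb{N}^{\mathbb{N}}\to X$; $p$ is a name of $x$ if $\delta_X(p)=x$. A problem is a partial multi-valued function $f:\subseteq X\rightrightarrows Y$ between represented spaces. $f\le_{\mathrm{W}} g$ (Weihrauch reducibility) means that there are computable partial maps $\Phi,\Psi:\subseteq\mathbb{N}^{\mathbb{N}}\to\mathbb{N}^{\mathbb{N}}$ such that for every name $p$ of some $x\in\mathrm{dom}(f)$, $\Phi(p)$ is a name of some $y\in\mathrm{dom}(g)$, and for every name $q$ of an element of $g(y)$, $\Psi(p*q)$ is a name of an element of $f(x)$, where $p*q$ is the interleaving of $p$ and $q$. $f\equiv_{\mathrm{W}}g$ means reducibility both ways. A tree is a nonempty subset $T$ of $\mathbb{N}^{<\mathbb{N}}$ closed under initial segments; $[T]$ is its set of infinite paths. $\mathcal{A}(\mathbb{N}^{\mathbb{N}})$ is the space of closed subsets of Baire space, a name of $C$ being (the characteristic function of) a tree $T$ with $[T]=C$; this is equivalent to the usual negative representation. $2=\{0,1\}$, $\mathbb{N}^{\mathbb{N}}$, products and sequence spaces carry the standard representations. A closed set is perfect if it has no isolated points; the perfect kernel of a closed set $A$ is the unique perfect $P\subseteq A$ with $A\setminus P$ countable, and $A\setminus P$ is the scattered part of $A$. $\mathsf{PK}_{\mathbb{N}^{\mathbb{N}}}:\mathcal{A}(\mathbb{N}^{\mathbb{N}})\to\mathcal{A}(\mathbb{N}^{\mathbb{N}})$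 maps a closed set to its perfect kernel. $\mathsf{wScList}_{\mathbb{N}^{\mathbb{N}}}:\mathcal{A}(\mathbb{N}^{\mathbb{N}})\rightrightarrows(2\times\mathbb{N}^{\mathbb{N}})^{\mathbb{N}}$ is defined on all closed sets by $\mathsf{wScList}_{\mathbb{N}^{\mathbb{N}}}(A)=\{(b_i,x_i)_{i\in\mathbb{N}}:A\setminus\mathsf{PK}_{\mathbb{N}^{\mathbb{N}}}(A)=\{x_i:b_i=1\}\}$. *)

(* Defs.v *)
From mathcomp Require Import all_boot all_classical topology.
From Stdlib Require Cantor.

Set Implicit Arguments.
Unset Strict Implicit.
Unset Printing Implicit Defensive.

Local Open Scope classical_set_scope.

(* The library makes [nat] a discrete space, so this is the usual product
   topology on Baire space. *)
Notation baire := (prod_topology (fun _ : nat => nat)).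

(* Kleene's partial recursive functions with an oracle in Baire space.
   Arguments are passed as a list. Missing arguments read as 0. *)
Inductive code : Type :=
| Zero
| Succ
| Proj of nat
| Oracle
| Comp of code & seq code
| Rec of code & code
| Mu of code.

(* [eval p c xs z]: the program [c] with oracle [p] halts on [xs] with output
   [z].  [Rec f g] is r(0, t) = f(t), r(n+1, t) = g(n, r(n, t), t), and
   [Mu f] is the least z with f(z, xs) = 0, where all the values f(i, xs) for
   i < z have to be defined. *)
Fixpoint eval (p : baire) (c : code) : seq nat -> nat -> Prop :=
  match c with
  | Zero => fun xs z => z = 0
  | Succ => fun xs z => z = (head 0 xs).+1
  | Proj i => fun xs z => z = nth 0 xs i
  | Oracle => fun xs z => z = p (head 0 xs)
  | Comp f gs => fun xs z =>
      exists2 ys,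
        (fix evals (gs : seq code) (ys : seq nat) {struct gs} : Prop :=
           match gs, ys with
           | [::], [::] => True
           | g :: gs', y :: ys' => eval p g xs y /\ evals gs' ys'
           | _, _ => False
           end) gs ys
        & eval p f ys z
  | Rec f g => fun xs z =>
      (fix rec (n : nat) (z : nat) {struct n} : Prop :=
         match n with
         | 0 => eval p f (behead xs) z
         | m.+1 => exists2 r, rec m r & eval p g [:: m, r & behead xs] z
         end) (head 0 xs) z
  | Mu f => fun xs z =>
      eval p f (z :: xs) 0 /\
      forall i, i < z -> exists k, eval p f (i :: xs) k.+1
  end.

Lemma eval_functional p c xs y z : eval p c xs y -> eval p c xs z -> y = z.
Proof.
move: c xs y z; fix IH 1 => -[||i||f gs|f g|f] xs y z /=.
- by move=> -> ->.
- by move=> -> ->.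
- by move=> -> ->.
- by move=> -> ->.
- move=> [ys ysE fy] [zs zsE fz].
  suff E : ys = zs by rewrite E in fy; exact: IH fy fz.
  clear fy fz; move: gs ys zs ysE zsE; fix IHs 1 => -[|g gs] [|a ys] [|b zs] //=.
  by move=> [ga gys] [gb gzs]; rewrite (IH _ _ _ _ ga gb) (IHs _ _ _ gys gzs).
- elim: (head 0 xs) y z => [|n IHn] y z; first exact: IH.
  by move=> [r Hr gy] [s Hs gz]; rewrite (IHn _ _ Hr Hs) in gy; exact: IH gy gz.
- move=> [fy ylt] [fz zlt]; case: (ltngtP y z) => // lt.
  + by have [k fk] := zlt _ lt; have := IH _ _ _ _ fy fk.
  + by have [k fk] := ylt _ lt; have := IH _ _ _ _ fz fk.
Qed.

(* A partial map is computable if some program computes all the digits of its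
   values; nothing is required outside its domain. *)
Definition computable (F : baire -> option baire) : Prop :=
  exists c : code, forall p q, F p = Some q -> forall n, eval p c [:: n] (q n).

(* [name] is the graph of the representation, a partial surjection. *)
Record rep_space : Type := RepSpace {
  carrier :> Type;
  name : baire -> carrier -> Prop;
  name_functional : forall p x y, name p x -> name p y -> x = y;
  name_surjective : forall x, exists p, name p x }.

Definition interleave (p q : baire) : baire :=
  fun n => if odd n then q n./2 else p n./2.

Definition baire_name (p x : baire) : Prop := p = x.

Lemma baire_name_functional p x y : baire_name p x -> baire_name p y -> x = y.
Proof. by move=> <- <-. Qed.

Lemma baire_name_surjective x : exists p, baire_name p x.
Proof. by exists x. Qed.

Definition baire_space : rep_space :=
  RepSpace baire_name_functional baire_name_surjective.

Definition bool_name (p : baire) (b : bool) : Prop := p 0 = nat_of_bool b.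

Lemma bool_name_functional p x y : bool_name p x -> bool_name p y -> x = y.
Proof. by rewrite /bool_name => ->; case: x; case: y. Qed.

Lemma bool_name_surjective b : exists p, bool_name p b.
Proof. by exists (fun=> nat_of_bool b). Qed.

Definition bool_space : rep_space :=
  RepSpace bool_name_functional bool_name_surjective.

Section Products.
Variables X Y : rep_space.

Definition prod_name (p : baire) (z : X * Y) : Prop :=
  exists q r, [/\ p = interleave q r, name q z.1 & name r z.2].

Lemma interleave_inj q r q' r' :
  interleave q r = interleave q' r' -> q = q' /\ r = r'.
Proof.
move=> E; split; apply/funext => n.
- by have := congr1 (@^~ n.*2) E; rewrite /interleave odd_double doubleK.
- have := congr1 (@^~ n.*2.+1) E.
  by rewrite /interleave /= odd_double /= uphalf_double.
Qed.

Lemma prod_name_functional p x y : prod_name p x -> prod_name p y -> x = y.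
Proof.
move=> [q [r [-> x1 x2]]] [q' [r' [/interleave_inj[<- <-] y1 y2]]].
case: x y x1 x2 y1 y2 => [x1 x2] [y1 y2] /= hx1 hx2 hy1 hy2.
by rewrite (name_functional hx1 hy1) (name_functional hx2 hy2).
Qed.

Lemma prod_name_surjective x : exists p, prod_name p x.
Proof.
have [q hq] := name_surjective x.1; have [r hr] := name_surjective x.2.
by exists (interleave q r), q, r.
Qed.

Definition prod_space : rep_space :=
  RepSpace prod_name_functional prod_name_surjective.

(* p = <p_0, p_1, ...>, where p<i, n> = p_i(n) for the Cantor pairing. *)
Definition seq_name (p : baire) (x : nat -> X) : Prop :=
  forall i, name (fun n => p (Cantor.to_nat (i, n))) (x i).

Lemma seq_name_functional p x y : seq_name p x -> seq_name p y -> x = y.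
Proof.
by move=> hx hy; apply/funext => i; exact: name_functional (hx i) (hy i).
Qed.

Lemma seq_name_surjective x : exists p, seq_name p x.
Proof.
have [q hq] := choice (fun i => name_surjective (x i)).
exists (fun m => q (Cantor.of_nat m).1 (Cantor.of_nat m).2) => i.
rewrite (_ : (fun n => _) = q i) //.
by apply/funext => n; rewrite Cantor.cancel_of_to.
Qed.

Definition seq_space : rep_space :=
  RepSpace seq_name_functional seq_name_surjective.

End Products.

Definition is_tree (T : pred (seq nat)) : Prop :=
  (exists s, T s) /\ forall s t, prefix s t -> T t -> T s.

Definition paths (T : pred (seq nat)) : set baire :=
  [set x | forall n, T (mkseq x n)].

Definition closed_set : Type := {C : set baire | closed C}.

(* [CodeSeq.code] is a computable bijection from finite sequences to nat. *)
Definition closed_name (p : baire) (C : closed_set) : Prop :=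
  exists T : pred (seq nat),
    [/\ is_tree T,
        forall s, p (CodeSeq.code s) = nat_of_bool (T s)
      & paths T = sval C].

Lemma closed_name_functional p x y : closed_name p x -> closed_name p y -> x = y.
Proof.
move=> [T [_ pT Tx]] [U [_ pU Uy]]; apply: eq_sig_hprop => [? ? ?|]; first exact: Prop_irrelevance.
rewrite -Tx -Uy.
congr paths; apply/funext => s.
by have := pT s; rewrite pU; case: (T s); case: (U s).
Qed.

Lemma closed_name_surjective C : exists p, closed_name p C.
Proof.
case: C => C cC.
pose T (s : seq nat) :=
  (s == [::]) || `[< exists2 x : baire, C x & s = mkseq x (size s) >].
exists (fun n => nat_of_bool (T (CodeSeq.decode n))), T; split.
- split; first by exists [::].
  move=> s t /prefixP[u ->] /orP[|].
    by move: s => [].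
  move=> /asboolP[x Cx E]; apply/orP; right; apply/asboolP; exists x => //.
  have := congr1 (take (size s)) E; rewrite take_size_cat // => {1}->.
  by rewrite /mkseq -map_take take_iota (minn_idPl _) // size_cat leq_addr.
- by move=> s; rewrite CodeSeq.codeK.
apply/seteqP; split => [x Tx|x Cx n] /=; last first.
  rewrite /T; apply/orP; right; apply/asboolP; exists x => //.
  by rewrite size_mkseq.
have /choice[y hy] : forall n, exists y : baire,
    C y /\ forall i, i < n -> y i = x i.
  move=> n; have := Tx n.+1; rewrite /T -size_eq0 size_mkseq /=.
  move=> /asboolP[y Cy E]; exists y; split=> // i lt.
  have := congr1 (nth 0 ^~ i) E.
  by rewrite !nth_mkseq // ltnW.
apply: (@closed_cvg _ _ _ eventually_filter y C cC) => //.
  by apply: nearW => n; have [] := hy n.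
apply/pointwise_cvgP => i; apply: cvg_near_cst.
by exists i.+1 => // n /= lt; have [_ ->] := hy n.
Qed.

Definition closed_space : rep_space :=
  RepSpace closed_name_functional closed_name_surjective.

Definition problem (X Y : rep_space) : Type := X -> set Y.

Definition dom X Y (f : problem X Y) : set X := [set x | f x !=set0].

Definition weihrauch_le X Y Z W (f : problem X Y) (g : problem Z W) : Prop :=
  exists Phi Psi : baire -> option baire,
    [/\ computable Phi, computable Psi &
      forall p x, name p x -> dom f x ->
        exists q y, [/\ Phi p = Some q, name q y, dom g y &
          forall r z, g y z -> name r z ->
            exists s w, [/\ Psi (interleave p r) = Some s, name s w & f x w]]].

Definition weihrauch_equiv X Y Z W (f : problem X Y) (g : problem Z W) : Prop :=
  weihrauch_le f g /\ weihrauch_le g f.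

Definition is_perfect_kernel (A P : set baire) : Prop :=
  [/\ perfect_set P, P `<=` A & countable (A `\` P)].

(* By the Cantor-Bendixson theorem every closed set has exactly one perfect
   kernel, so both problems below are defined on all closed sets, and [PK] is
   single-valued. *)
Definition PK : problem closed_space closed_space :=
  fun A => [set P | is_perfect_kernel (sval A) (sval P)].

Definition wScList :
    problem closed_space (seq_space (prod_space bool_space baire_space)) :=
  fun A => [set s | exists2 P, PK A P &
    sval A `\` sval P = [set x | exists i, s i = (true, x)]].

(* Main.v *)
From mathcomp Require Import all_boot all_classical topology zify.
From Stdlib Require Cantor.
Require Import Defs.

Set Implicit Arguments.
Unset Strict Implicit.
Unset Printing Implicit Defensive.

Local Open Scope classical_set_scope.
Local Notation enc := CodeSeq.code.
Local Notation dec := CodeSeq.decode.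

(* Let T be a tree, and let a node a survive a derivative step if it has two
   incompatible extensions in T which have survived so far. The nodes that
   survive all steps are the initial segments of the perfect kernel P of [T].
   If x is in [T] \ P, then the ranks of its initial segments are eventually
   constant; if s is an initial segment from where on this is the case, then
   the nodes above s of the same rank form a chain, so x is determined by s: t is
   an initial segment of x iff t has arbitrarily long extensions whose rank is not
   smaller than that of s. Comparing ranks is Sigma^1_1 (there is a relation
   closed under a back-and-forth step), so "s and t are such a pair" is Pi^1_1.

   From T one computes a tree U such that [U] is the disjoint union, over the
   pairs (s, t), of closed sets C(s, t), where C(s, t) is just the point 0^omega
   when (s, t) is such a pair, while otherwise it also contains, after each finite
   run of zeros, a perfect set of witnesses and so is itself perfect. Hence the
   scattered part of [U] consists of the points (s, t) 0^omega for those pairs,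
   and either the perfect kernel of [U] or a list of its scattered part allows
   one to enumerate them. Such an enumeration suffices to list [T] \ P, and, as
   x in [T] is outside P iff (s, s) is enumerated for some initial segment s of x,
   also to compute a tree for P. *)

(** * Functions computable with an oracle *)

(* The [k] arguments are the first values of [e]. With arguments as a function,
   the indices of variables under a binder simplify by computation. *)
Definition rcomp (k : nat) (F : baire -> (nat -> nat) -> nat) : Prop :=
  exists c, forall p e, eval p c (mkseq e k) (F p e).

Lemma eval_comp p f gs xs ys z : size gs = size ys ->
  (forall i, i < size gs -> eval p (nth Zero gs i) xs (nth 0 ys i)) ->
  eval p f ys z -> eval p (Comp f gs) xs z.
Proof.
move=> + + fz; move=> sz h /=; exists ys => //; clear fz.
elim: gs ys sz h => [|g gs IH] [|y ys] //= [sz] h.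
by split; [exact: (h 0)|apply: IH => // i lt; exact: (h i.+1)].
Qed.

Lemma rcomp_ext k F G : (forall p e, F p e = G p e) -> rcomp k F -> rcomp k G.
Proof. by move=> FG [c h]; exists c => p e; rewrite -FG. Qed.

Lemma rcomp_var k i : i < k -> rcomp k (fun p e => e i).
Proof. by move=> lt; exists (Proj i) => p e /=; rewrite nth_mkseq. Qed.

Lemma rcomp_subst n k F (G : nat -> baire -> (nat -> nat) -> nat) :
  rcomp n F -> (forall i, i < n -> rcomp k (G i)) ->
  rcomp k (fun p e => F p (fun i => G i p e)).
Proof.
move=> [f hf] hG.
have /choice[g hg] : forall i, exists c, i < n ->
    forall p e, eval p c (mkseq e k) (G i p e).
  by move=> i; case: (ltnP i n) => [/hG[c h]|_]; [exists c|exists Zero].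
exists (Comp f (mkseq g n)) => p e.
apply: (@eval_comp _ _ _ _ (mkseq (fun i => G i p e) n)).
- by rewrite !size_mkseq.
- by rewrite size_mkseq => i lt; rewrite !nth_mkseq //; exact: hg.
- exact: hf.
Qed.

Lemma rcomp_app1 k (f : baire -> nat -> nat) F :
  rcomp 1 (fun p e => f p (e 0)) -> rcomp k F ->
  rcomp k (fun p e => f p (F p e)).
Proof. by move=> hf hF; exact: (rcomp_subst (G := fun=> F) hf). Qed.

Lemma rcomp_app2 k (f : baire -> nat -> nat -> nat) F G :
  rcomp 2 (fun p e => f p (e 0) (e 1)) -> rcomp k F -> rcomp k G ->
  rcomp k (fun p e => f p (F p e) (G p e)).
Proof.
move=> hf hF hG.
by apply: (rcomp_subst (G := nth G [:: F]) hf) => -[|[|]].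
Qed.

Lemma rcomp_app3 k (f : baire -> nat -> nat -> nat -> nat) F G H :
  rcomp 3 (fun p e => f p (e 0) (e 1) (e 2)) ->
  rcomp k F -> rcomp k G -> rcomp k H ->
  rcomp k (fun p e => f p (F p e) (G p e) (H p e)).
Proof.
move=> hf hF hG hH.
by apply: (rcomp_subst (G := nth H [:: F; G]) hf) => -[|[|[|]]].
Qed.

Lemma rcomp_succ k F : rcomp k F -> rcomp k (fun p e => (F p e).+1).
Proof.
apply: (rcomp_app1 (f := fun p i => i.+1)).
by exists Succ => p e.
Qed.

Lemma rcomp_const k n : rcomp k (fun p e => n).
Proof.
elim: n => [|n IH]; first by exists Zero.
exact: rcomp_succ.
Qed.

Lemma rcomp_oracle k F : rcomp k F -> rcomp k (fun p e => p (F p e)).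
Proof.
by apply: (rcomp_app1 (f := fun p i => p i)); exists Oracle => p e.
Qed.

(** [Rec] recurses on the head of the argument list, so the iteration is first programmed with its
    length as an extra leading argument, for which [N] is then substituted. *)
Lemma rcomp_iteri k N F (G : baire -> (nat -> nat) -> nat -> nat -> nat) :
  rcomp k N -> rcomp k F ->
  rcomp k.+2 (fun p e => G p (fun i => e i.+2) (e 0) (e 1)) ->
  rcomp k (fun p e => iteri (N p e) (G p e) (F p e)).
Proof.
move=> hN [f hf] [g hg].
suff h : rcomp k.+1
    (fun p e => iteri (e 0) (G p (fun i => e i.+1)) (F p (fun i => e i.+1))).
  apply: (rcomp_subst (G := fun i => if i is j.+1 then fun p e => e j else N) h).
  by case=> // i lt; exact: rcomp_var.
have consE m (h : nat -> nat) : mkseq h m.+1 = h 0 :: mkseq (fun i => h i.+1) m.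
  by rewrite /mkseq /= (iotaDl 1) -map_comp.
exists (Rec f g) => p e; rewrite consE /=.
elim: (e 0) => [|n IH]; first exact: hf.
exists (iteri n (G p (fun i => e i.+1)) (F p (fun i => e i.+1))) => //.
pose e' i := if i is j.+1 then
  if j is l.+1 then e l.+1
  else iteri n (G p (fun i => e i.+1)) (F p (fun i => e i.+1)) else n.
by have := hg p e'; rewrite !consE.
Qed.

(** * Arithmetic, logic and bounded search *)

Lemma rcomp_pred k F : rcomp k F -> rcomp k (fun p e => (F p e).-1).
Proof.
move=> hF; apply: (@rcomp_ext _ (fun p e => iteri (F p e) (fun i _ => i) 0)).
  by move=> p e; case: (F p e).
apply: rcomp_iteri => //; first exact: rcomp_const.
exact: rcomp_var.
Qed.

Section Arithmetic.
Variables (k : nat) (F G : baire -> (nat -> nat) -> nat).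
Hypotheses (hF : rcomp k F) (hG : rcomp k G).

Lemma rcomp_add : rcomp k (fun p e => F p e + G p e).
Proof.
apply: (@rcomp_ext _ (fun p e => iteri (G p e) (fun _ r => r.+1) (F p e))).
  move=> p e; elim: (G p e) => [|n IH] /=; first by rewrite addn0.
  by rewrite IH addnS.
by apply: rcomp_iteri => //; apply: rcomp_succ; exact: rcomp_var.
Qed.

Lemma rcomp_sub : rcomp k (fun p e => F p e - G p e).
Proof.
apply: (@rcomp_ext _ (fun p e => iteri (G p e) (fun _ r => r.-1) (F p e))).
  move=> p e; elim: (G p e) => [|n IH] /=; first by rewrite subn0.
  by rewrite IH subnS.
by apply: rcomp_iteri => //; apply: rcomp_pred; exact: rcomp_var.
Qed.

Lemma rcomp_eq0 : rcomp k (fun p e => F p e == 0).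
Proof.
apply: (@rcomp_ext _ (fun p e => iteri (F p e) (fun _ _ => 0) 1)).
  by move=> p e; case: (F p e).
by apply: rcomp_iteri => //; exact: rcomp_const.
Qed.

End Arithmetic.

Lemma rcomp_mul k F G :
  rcomp k F -> rcomp k G -> rcomp k (fun p e => F p e * G p e).
Proof.
move=> hF hG; apply: (rcomp_app2 (f := fun p => muln) _ hF hG).
apply: (@rcomp_ext _ (fun p e => iteri (e 1) (fun _ r => r + e 0) 0)).
  move=> p e; elim: (e 1) => [|n IH] /=; first by rewrite muln0.
  by rewrite IH mulnS addnC.
apply: rcomp_iteri; first exact: rcomp_var; first exact: rcomp_const.
by apply: rcomp_add; exact: rcomp_var.
Qed.

Section Logic.
Variables (k : nat) (F G : baire -> (nat -> nat) -> nat).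
Variables (A B : baire -> (nat -> nat) -> bool).
Hypotheses (hF : rcomp k F) (hG : rcomp k G).
Hypotheses (hA : rcomp k (fun p e => A p e)) (hB : rcomp k (fun p e => B p e)).

Lemma rcomp_leq : rcomp k (fun p e => F p e <= G p e).
Proof. by apply: rcomp_eq0; exact: rcomp_sub. Qed.

Lemma rcomp_neg : rcomp k (fun p e => ~~ A p e).
Proof.
apply: (@rcomp_ext _ (fun p e => A p e == 0 :> nat)); last exact: rcomp_eq0.
by move=> p e; case: (A p e).
Qed.

Lemma rcomp_and : rcomp k (fun p e => A p e && B p e).
Proof.
apply: (@rcomp_ext _ (fun p e => A p e * B p e)); last exact: rcomp_mul.
by move=> p e; case: (A p e); case: (B p e).
Qed.

Lemma rcomp_if : rcomp k (fun p e => if A p e then F p e else G p e).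
Proof.
apply: (@rcomp_ext _ (fun p e => A p e * F p e + ~~ A p e * G p e)).
  by move=> p e; case: (A p e); rewrite !(mul0n, mul1n, addn0, add0n).
by apply: rcomp_add; apply: rcomp_mul => //; exact: rcomp_neg.
Qed.

End Logic.

Lemma rcomp_or k (A B : baire -> (nat -> nat) -> bool) :
  rcomp k (fun p e => A p e) -> rcomp k (fun p e => B p e) ->
  rcomp k (fun p e => A p e || B p e).
Proof.
move=> hA hB; apply: (@rcomp_ext _ (fun p e => ~~ (~~ A p e && ~~ B p e))).
  by move=> p e; rewrite negb_and !negbK.
by apply: rcomp_neg; apply: rcomp_and; exact: rcomp_neg.
Qed.

Lemma rcomp_implb k (A B : baire -> (nat -> nat) -> bool) :
  rcomp k (fun p e => A p e) -> rcomp k (fun p e => B p e) ->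
  rcomp k (fun p e => A p e ==> B p e).
Proof.
move=> hA hB; apply: (@rcomp_ext _ (fun p e => ~~ A p e || B p e)).
  by move=> p e; rewrite implybE.
by apply: rcomp_or => //; exact: rcomp_neg.
Qed.

Lemma rcomp_eq k F G :
  rcomp k F -> rcomp k G -> rcomp k (fun p e => F p e == G p e).
Proof.
move=> hF hG.
apply: (@rcomp_ext _ (fun p e => (F p e <= G p e) && (G p e <= F p e))).
  by move=> p e; rewrite eqn_leq.
by apply: rcomp_and; exact: rcomp_leq.
Qed.

Lemma rcomp_find k N (A : baire -> (nat -> nat) -> nat -> bool) :
  rcomp k N -> rcomp k.+1 (fun p e => A p (fun i => e i.+1) (e 0)) ->
  rcomp k (fun p e => find (A p e) (iota 0 (N p e))).
Proof.
move=> hN hA.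
(* The accumulator keeps pace with the counter until a hit and then stays there, so [r < i] means
   that the search is over. *)
apply: (@rcomp_ext _ (fun p e =>
    iteri (N p e) (fun i r => if r < i then r else i + ~~ A p e i) 0)).
  move=> p e; elim: (N p e) => // n IH; rewrite [LHS]/= IH.
  have -> : iota 0 n.+1 = iota 0 n ++ [:: n] by rewrite -addn1 iotaD.
  rewrite find_cat has_find size_iota.
  by case: ltnP => //= _; case: (A p e n).
apply: rcomp_iteri => //; first exact: rcomp_const.
have hv i : i < 2 -> rcomp k.+2 (fun p e => e i).
  by move=> lt; apply: rcomp_var; lia.
apply: rcomp_if; [exact: hv|apply: rcomp_add; first exact: hv|].
  apply: rcomp_neg.
  apply: (@rcomp_subst _ _ _ (fun i p e => e (if i is j.+1 then j.+2 else 0)) hA).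
  by move=> [|i] lt; exact: rcomp_var.
by apply: rcomp_leq; [apply: rcomp_succ|]; exact: hv.
Qed.

Lemma rcomp_has k N (A : baire -> (nat -> nat) -> nat -> bool) :
  rcomp k N -> rcomp k.+1 (fun p e => A p (fun i => e i.+1) (e 0)) ->
  rcomp k (fun p e => has (A p e) (iota 0 (N p e))).
Proof.
move=> hN hA.
apply: (@rcomp_ext _ (fun p e => find (A p e) (iota 0 (N p e)) < N p e)).
  by move=> p e; rewrite has_find size_iota.
by apply: rcomp_leq => //; apply: rcomp_succ; exact: rcomp_find.
Qed.

Lemma rcomp_all k N (A : baire -> (nat -> nat) -> nat -> bool) :
  rcomp k N -> rcomp k.+1 (fun p e => A p (fun i => e i.+1) (e 0)) ->
  rcomp k (fun p e => all (A p e) (iota 0 (N p e))).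
Proof.
move=> hN hA; apply: (@rcomp_ext _
    (fun p e => ~~ has (fun i => ~~ A p e i) (iota 0 (N p e)))).
  move=> p e; rewrite -all_predC; congr nat_of_bool; apply: eq_all => i /=.
  by rewrite negbK.
by apply: rcomp_neg; apply: rcomp_has => //; exact: rcomp_neg.
Qed.

Lemma rcomp_double k F : rcomp k F -> rcomp k (fun p e => (F p e).*2).
Proof.
move=> hF; apply: (@rcomp_ext _ (fun p e => F p e + F p e)).
  by move=> p e; rewrite addnn.
exact: rcomp_add.
Qed.

Lemma rcomp_exp k m F : rcomp k F -> rcomp k (fun p e => m ^ F p e).
Proof.
move=> hF; apply: (@rcomp_ext _ (fun p e => iteri (F p e) (fun _ r => m * r) 1)).
  by move=> p e; elim: (F p e) => //= n ->; rewrite expnS.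
apply: rcomp_iteri => //; first exact: rcomp_const.
by apply: rcomp_mul; [exact: rcomp_const|exact: rcomp_var].
Qed.

Lemma rcomp_half k F : rcomp k F -> rcomp k (fun p e => (F p e)./2).
Proof.
apply: (rcomp_app1 (f := fun p n => n./2)).
(* [n./2] is the least [i] with [n <= i.*2.+1]. *)
apply: (@rcomp_ext _ (fun p e =>
    find (fun i => e 0 <= i.*2.+1) (iota 0 (e 0)))).
  move=> p e; set n := e 0.
  have [->//|n0] := posnP n.
  have h2 : n./2 < n by lia.
  have -> : n = n./2 + (n - n./2) by lia.
  rewrite iotaD find_cat add0n.
  have -> : n./2 + (n - n./2) = n by lia.
  rewrite ifF; last by apply/hasP => -[i]; rewrite mem_iota /=; lia.
  have -> : n - n./2 = (n - n./2).-1.+1 by lia.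
  by rewrite /= size_iota ifT; lia.
apply: rcomp_find; first exact: rcomp_var.
apply: rcomp_leq; first exact: rcomp_var.
by apply: rcomp_succ; apply: rcomp_double; exact: rcomp_var.
Qed.

Lemma rcomp_odd k F : rcomp k F -> rcomp k (fun p e => odd (F p e)).
Proof.
move=> hF; apply: (@rcomp_ext _ (fun p e => F p e - (F p e)./2.*2)).
  by move=> p e; lia.
by apply: rcomp_sub => //; apply: rcomp_double; exact: rcomp_half.
Qed.

(** * Decoding finite sequences and pairs *)

Lemma find_iota (a : pred nat) n i :
  i < n -> a i -> (forall j, j < i -> ~~ a j) -> find a (iota 0 n) = i.
Proof.
move=> lt ai na; have -> : n = i + (n - i).-1.+1 by lia.
rewrite iotaD find_cat add0n /= ai size_iota addn0 ifF //.
by apply/hasP => -[j]; rewrite mem_iota => /= /na /negP.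
Qed.

Lemma code_cons x s : enc (x :: s) = 2 ^ x * (enc s).*2.+1.
Proof. by []. Qed.

Lemma code_inj : injective CodeSeq.code.
Proof. exact: can_inj CodeSeq.codeK. Qed.

Lemma ltn_code_mem s x : x \in s -> x < enc s.
Proof. by move: (CodeSeq.ltn_code s) => /allP; apply. Qed.

Lemma ltn_code_behead x s : enc s < enc (x :: s).
Proof.
rewrite code_cons.
have : 0 < 2 ^ x by rewrite expn_gt0.
by move: (2 ^ x) (enc s) => a b; nia.
Qed.

Lemma size_le_code s : size s <= enc s.
Proof. by elim: s => // x s IH; exact: leq_ltn_trans (ltn_code_behead x s). Qed.

(** By [code_cons], decoding means factoring into a power of 2 and an odd number. The head and the
    code of the tail are below the code, so bounded search finds them; on 0, the code of the empty
    sequence, both searches return 0. *)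
Definition dec_tail n :=
  find (fun t => has (fun h => 2 ^ h * t.*2.+1 == n) (iota 0 n)) (iota 0 n).
Definition dec_head n :=
  find (fun h => has (fun t => 2 ^ h * t.*2.+1 == n) (iota 0 n)) (iota 0 n).

Lemma dec_tailE s : dec_tail (enc s) = enc (behead s).
Proof.
case: s => // x s; apply: find_iota; first exact: ltn_code_behead.
  apply/hasP; exists x => //.
  by rewrite mem_iota ltn_code_mem // mem_head.
move=> t /= lt; apply/hasP => -[h _ /eqP].
rewrite -[t]CodeSeq.decodeK -!code_cons => /code_inj [_] E; move: lt.
by rewrite -E CodeSeq.decodeK ltnn.
Qed.

Lemma dec_headE s : dec_head (enc s) = head 0 s.
Proof.
case: s => // x s; apply: find_iota; first by rewrite ltn_code_mem // mem_head.
  apply/hasP; exists (enc s) => //.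
  by rewrite mem_iota ltn_code_behead.
move=> h /= lt; apply/hasP => -[t _ /eqP].
rewrite -[t]CodeSeq.decodeK -!code_cons => /code_inj [E]; move: lt.
by rewrite E ltnn.
Qed.

Definition dec_drop n i := iteri i (fun _ r => dec_tail r) n.

Lemma dec_dropE n i : dec_drop n i = enc (drop i (dec n)).
Proof.
elim: i => [|i IH] /=; first by rewrite drop0 CodeSeq.decodeK.
by rewrite /dec_drop /= -/(dec_drop n i) IH dec_tailE -[behead _]drop1 drop_drop.
Qed.

Lemma dec_nthE n i : dec_head (dec_drop n i) = nth 0 (dec n) i.
Proof. by rewrite dec_dropE dec_headE -nth0 nth_drop addn0. Qed.

Lemma dec_sizeE n :
  find (fun i => dec_drop n i == 0) (iota 0 n) = size (dec n).
Proof.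
have drop0E i : (dec_drop n i == 0) = (size (dec n) <= i).
  rewrite dec_dropE -[0]/(enc [::]) (inj_eq code_inj).
  by rewrite -size_eq0 size_drop subn_eq0.
(* If the size equals [n], the search below [n] fails and returns its bound, which is again the
   size. *)
have := size_le_code (dec n); rewrite CodeSeq.decodeK leq_eqVlt => /orP[/eqP E|lt].
  rewrite E hasNfind; first exact: size_iota.
  by apply/hasP => -[i]; rewrite mem_iota /= drop0E E; case: ltnP.
by apply: find_iota => // [|i]; rewrite drop0E // ltnNge.
Qed.

Lemma rcomp_dec_tail k F : rcomp k F -> rcomp k (fun p e => dec_tail (F p e)).
Proof.
apply: (rcomp_app1 (f := fun p => dec_tail)).
apply: rcomp_find; first exact: rcomp_var.
apply: rcomp_has; first exact: rcomp_var.
apply: rcomp_eq; last exact: rcomp_var.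
apply: rcomp_mul; first by apply: rcomp_exp; exact: rcomp_var.
by apply: rcomp_succ; apply: rcomp_double; exact: rcomp_var.
Qed.

Lemma rcomp_dec_head k F : rcomp k F -> rcomp k (fun p e => dec_head (F p e)).
Proof.
apply: (rcomp_app1 (f := fun p => dec_head)).
apply: rcomp_find; first exact: rcomp_var.
apply: rcomp_has; first exact: rcomp_var.
apply: rcomp_eq; last exact: rcomp_var.
apply: rcomp_mul; first by apply: rcomp_exp; exact: rcomp_var.
by apply: rcomp_succ; apply: rcomp_double; exact: rcomp_var.
Qed.

Lemma rcomp_dec_drop k F G : rcomp k F -> rcomp k G ->
  rcomp k (fun p e => dec_drop (F p e) (G p e)).
Proof.
move=> hF hG; apply: rcomp_iteri => //.
by apply: rcomp_dec_tail; exact: rcomp_var.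
Qed.

Lemma rcomp_nth k F G : rcomp k F -> rcomp k G ->
  rcomp k (fun p e => nth 0 (dec (F p e)) (G p e)).
Proof.
move=> hF hG; apply: (@rcomp_ext _ (fun p e => dec_head (dec_drop (F p e) (G p e)))).
  by move=> p e; rewrite dec_nthE.
by apply: rcomp_dec_head; exact: rcomp_dec_drop.
Qed.

Lemma rcomp_size k F : rcomp k F -> rcomp k (fun p e => size (dec (F p e))).
Proof.
apply: (rcomp_app1 (f := fun p n => size (dec n))).
apply: (@rcomp_ext _
    (fun p e => find (fun i => dec_drop (e 0) i == 0) (iota 0 (e 0)))).
  by move=> p e; rewrite dec_sizeE.
apply: rcomp_find; first exact: rcomp_var.
by apply: rcomp_eq0; apply: rcomp_dec_drop; exact: rcomp_var.
Qed.

Lemma prefix_nthE (s t : seq nat) : prefix s t =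
  (size s <= size t) && all (fun i => nth 0 s i == nth 0 t i) (iota 0 (size s)).
Proof.
apply/idP/andP => [/prefixP[u ->]|[le /allP h]].
  rewrite size_cat leq_addr; split=> //; apply/allP => i.
  by rewrite mem_iota nth_cat => /= ->.
rewrite prefixE; apply/eqP/(@eq_from_nth _ 0); first by rewrite size_takel.
move=> i; rewrite size_takel // => lt; rewrite nth_take //.
by apply/esym/eqP/h; rewrite mem_iota.
Qed.

Lemma rcomp_prefix k F G : rcomp k F -> rcomp k G ->
  rcomp k (fun p e => prefix (dec (F p e)) (dec (G p e))).
Proof.
apply: (rcomp_app2 (f := fun p m n => prefix (dec m) (dec n))).
apply: (rcomp_ext (fun p e => congr1 nat_of_bool
  (esym (prefix_nthE (dec (e 0)) (dec (e 1)))))).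
apply: rcomp_and.
  by apply: rcomp_leq; apply: rcomp_size; exact: rcomp_var.
apply: rcomp_all; first by apply: rcomp_size; exact: rcomp_var.
by apply: rcomp_eq; apply: rcomp_nth; exact: rcomp_var.
Qed.

Lemma rcomp_code_nil k : rcomp k (fun p e => enc [::]).
Proof. exact: rcomp_const. Qed.

Lemma rcomp_code_cons k F (S : baire -> (nat -> nat) -> seq nat) :
  rcomp k F -> rcomp k (fun p e => enc (S p e)) ->
  rcomp k (fun p e => enc (F p e :: S p e)).
Proof.
move=> hF hS; apply: rcomp_mul; first exact: rcomp_exp.
by apply: rcomp_succ; exact: rcomp_double.
Qed.

Lemma rcomp_code_nseq k F n : rcomp k F ->
  rcomp k (fun p e => enc (nseq (F p e) n)).
Proof.
move=> hF.
apply: (@rcomp_ext _ (fun p e => iteri (F p e) (fun _ r => 2 ^ n * (r.*2).+1) 0)).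
  by move=> p e; elim: (F p e) => //= m ->.
apply: rcomp_iteri => //; first exact: rcomp_const.
apply: rcomp_mul; first exact: rcomp_const.
by apply: rcomp_succ; apply: rcomp_double; exact: rcomp_var.
Qed.

Lemma rcomp_cantor k F G : rcomp k F -> rcomp k G ->
  rcomp k (fun p e => Cantor.to_nat (F p e, G p e)).
Proof.
move=> hF hG; apply: (@rcomp_ext _ (fun p e =>
    G p e + iteri (G p e + F p e) (fun i m => i.+1 + m) 0)).
  move=> p e; move: (F p e) (G p e) => x y; rewrite /Cantor.to_nat plusE.
  by congr (_ + _); elim: (y + x) => //= n ->.
apply: rcomp_add => //; apply: rcomp_iteri; first exact: rcomp_add.
  exact: rcomp_const.
by apply: rcomp_add; [apply: rcomp_succ|]; exact: rcomp_var.
Qed.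

Lemma cantor_le i j : (i <= Cantor.to_nat (i, j)) && (j <= Cantor.to_nat (i, j)).
Proof. have := Cantor.to_nat_non_decreasing i j; rewrite plusE; lia. Qed.

(** Both components are bounded by the code ([cantor_le]), so bounded search inverts the pairing. *)
Lemma rcomp_cantor_inv k F : rcomp k F ->
  rcomp k (fun p e => (Cantor.of_nat (F p e)).1) /\
  rcomp k (fun p e => (Cantor.of_nat (F p e)).2).
Proof.
move=> hF; split.
  apply: (rcomp_app1 (f := fun p n => (Cantor.of_nat n).1)) hF.
  apply: (@rcomp_ext _ (fun p e => find (fun i => has (fun j =>
      Cantor.to_nat (i, j) == e 0) (iota 0 (e 0).+1)) (iota 0 (e 0).+1))).
    move=> p e; case E: (Cantor.of_nat (e 0)) => [i j]; rewrite [RHS]/=.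
    have {E}En : e 0 = Cantor.to_nat (i, j) by rewrite -E Cantor.cancel_to_of.
    have /andP[lei lej] := cantor_le i j.
    rewrite En; apply: find_iota; first by rewrite ltnS.
      by apply/hasP; exists j => //; rewrite mem_iota ltnS.
    move=> i' lt; apply/hasP => -[j' _ /eqP/Cantor.to_nat_inj[E]]; move: lt.
    by rewrite E ltnn.
  apply: rcomp_find; first by apply: rcomp_succ; exact: rcomp_var.
  apply: rcomp_has; first by apply: rcomp_succ; exact: rcomp_var.
  by apply: rcomp_eq; [apply: rcomp_cantor|]; exact: rcomp_var.
apply: (rcomp_app1 (f := fun p n => (Cantor.of_nat n).2)) hF.
apply: (@rcomp_ext _ (fun p e => find (fun j => has (fun i =>
    Cantor.to_nat (i, j) == e 0) (iota 0 (e 0).+1)) (iota 0 (e 0).+1))).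
  move=> p e; case E: (Cantor.of_nat (e 0)) => [i j]; rewrite [RHS]/=.
  have {E}En : e 0 = Cantor.to_nat (i, j) by rewrite -E Cantor.cancel_to_of.
  have /andP[lei lej] := cantor_le i j.
  rewrite En; apply: find_iota; first by rewrite ltnS.
    by apply/hasP; exists i => //; rewrite mem_iota ltnS.
  move=> j' lt; apply/hasP => -[i' _ /eqP/Cantor.to_nat_inj[_ E]]; move: lt.
  by rewrite E ltnn.
apply: rcomp_find; first by apply: rcomp_succ; exact: rcomp_var.
apply: rcomp_has; first by apply: rcomp_succ; exact: rcomp_var.
by apply: rcomp_eq; [apply: rcomp_cantor|]; exact: rcomp_var.
Qed.

(** * The derivative of a tree *)

Section Derivative.
Variable T : pred (seq nat).

Definition splits (a s0 s1 : seq nat) : bool :=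
  [&& T s0, T s1, prefix a s0, prefix a s1, ~~ prefix s0 s1 & ~~ prefix s1 s0].

Definition deriv (X : set (seq nat)) : set (seq nat) :=
  [set a | exists s0 s1, [/\ splits a s0 s1, X s0 & X s1]].

(** The transfinite iterates of [deriv], without ordinals. Intersections serve as limit steps; the
    empty family gives the initial stage, the set of all sequences. *)
Inductive stage : set (seq nat) -> Prop :=
| stage_deriv X : stage X -> stage (deriv X)
| stage_cap (F : set (set (seq nat))) :
    (forall X, F X -> stage X) -> stage (\bigcap_(X in F) X).

Lemma deriv_mono X Y : X `<=` Y -> deriv X `<=` deriv Y.
Proof. by move=> XY a [s0 [s1 [h /XY x0 /XY x1]]]; exists s0, s1. Qed.

Lemma stage_prefix X a b : stage X -> prefix a b -> X b -> X a.
Proof.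
move=> sX; elim: sX a b => [Y _ _|F _ IH] a b ab; last first.
  by move=> h Y FY; exact: IH FY _ _ ab (h Y FY).
move=> [s0 [s1 [/and5P[t0 t1 b0 b1 h] y0 y1]]]; exists s0, s1; split => //.
by apply/and5P; split=> //; exact: prefix_trans ab _.
Qed.

Lemma deriv_sub X : stage X -> deriv X `<=` X.
Proof.
move=> sX a [s0 [s1 [/and5P[_ _ a0 _ _] x0 _]]].
exact: stage_prefix sX a0 x0.
Qed.

(** Zermelo's argument for towers. Call a stage extremal if it lies in the derivative of every
    strictly larger stage. Extremal stages are comparable with all stages ([good_lin]), and by
    induction every stage is extremal. *)
Lemma stage_linear X Y : stage X -> stage Y -> X `<=` Y \/ Y `<=` deriv X.
Proof.
have good_lin X' : stage X' ->
    (forall Y', stage Y' -> X' `<=` Y' -> X' <> Y' -> X' `<=` deriv Y') ->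
    forall Y', stage Y' -> X' `<=` Y' \/ Y' `<=` deriv X'.
  move=> sX gX Y'; elim=> [Z sZ [XZ|ZX]|F sF IH].
  - have [->|/eqP ne] := eqVneq X' Z; first by right.
    by left; apply: gX => //; apply/eqP.
  - by right => a /(deriv_sub sZ) /ZX.
  - have [h|/existsNP[Z /not_implyP[FZ nZ]]] := pselect (forall Z, F Z -> X' `<=` Z).
      by left => a xa Z FZ; exact: h FZ a xa.
    have [//|ZX] := IH Z FZ.
    by right => a h; apply: ZX; exact: h.
move=> sX; move: Y; apply: (good_lin X sX); elim: sX => [Z sZ IH|F sF IH] Y sY.
- have [ZY|YZ] := good_lin Z sZ IH Y sY.
    by move=> _ _; exact: deriv_mono.
  by move=> dZY ne; case: ne; apply/seteqP.
- move=> XY ne.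
  have [Z FZ nYZ] : exists2 Z, F Z & ~ Y `<=` Z.
    apply: contrapT => h; apply: ne; apply/seteqP; split=> // a Ya Z FZ.
    by apply: contrapT => nZ; apply: h; exists Z => // /(_ a Ya).
  have [ZY|YZ] := good_lin Z (sF Z FZ) (IH Z FZ) Y sY.
    have ZneY : Z <> Y by move=> E; apply: nYZ; rewrite E.
    move=> a h; have := h Z FZ; exact: (IH Z FZ Y sY ZY ZneY).
  by case: nYZ => a /YZ /(deriv_sub (sF Z FZ)).
Qed.

Definition kernel : set (seq nat) := \bigcap_(X in stage) X.

Lemma stage_kernel : stage kernel.
Proof. exact: stage_cap. Qed.

Lemma deriv_kernel : deriv kernel = kernel.
Proof.
apply/seteqP; split; first exact: deriv_sub stage_kernel.
by move=> a; apply; apply: stage_deriv; exact: stage_kernel.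
Qed.

(** With [deriv_kernel], this makes the kernel the greatest fixed point of [deriv]. *)
Lemma post_fixpoint_kernel X : X `<=` deriv X -> X `<=` kernel.
Proof.
move=> Xd a Xa Y sY; elim: sY a Xa => [Z _ IH|F _ IH] a Xa.
  exact: deriv_mono IH a (Xd a Xa).
by move=> Z FZ; exact: IH.
Qed.

(* [last_stage a] is the smallest stage containing [a]: it plays the role of
   the rank of [a], with the inclusions reversed. *)
Definition last_stage (a : seq nat) : set (seq nat) :=
  \bigcap_(X in [set X | stage X /\ X a]) X.

Lemma stage_last a : stage (last_stage a).
Proof. by apply: stage_cap => X []. Qed.

Lemma last_stage_self a : last_stage a a.
Proof. by move=> X []. Qed.

Lemma last_stage_sub a X : stage X -> X a -> last_stage a `<=` X.
Proof. by move=> sX Xa b; apply. Qed.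

(** Otherwise [deriv (last_stage a)] is a stage containing [a], so minimality makes [last_stage a] a
    post-fixed point of [deriv]. *)
Lemma not_deriv_last_stage a : ~ kernel a -> ~ deriv (last_stage a) a.
Proof.
move=> nK da; apply: nK; apply: (@post_fixpoint_kernel (last_stage a)).
  by apply: last_stage_sub => //; apply: stage_deriv; exact: stage_last.
exact: last_stage_self.
Qed.

(* The largest progressive relation, [outranks a b], says that [a] is in the
   kernel or that the rank of [b] is smaller than the rank of [a]; see
   [outranksE].  Defining it without ranks makes it Sigma^1_1. *)
Definition progressive (R : seq nat -> seq nat -> Prop) : Prop :=
  forall a b, R a b -> exists s0 s1, splits a s0 s1 /\
    forall t0 t1, splits b t0 t1 ->
      (R s0 t0 \/ R s0 t1) /\ (R s1 t0 \/ R s1 t1).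

Definition outranks (a b : seq nat) : Prop :=
  exists2 R, progressive R & R a b.

Lemma progressive_outranks : progressive outranks.
Proof.
move=> a b [R pR Rab]; have [s0 [s1 [ss h]]] := pR a b Rab.
exists s0, s1; split=> // t0 t1 /h [h0 h1].
by split; [case: h0 => ?; [left|right]|case: h1 => ?; [left|right]]; exists R.
Qed.

(** If [a] outlasts [b], then [a] has a splitting inside [last_stage b], whereas every splitting of
    [b] has a side outside it. Both halves for [a] are then related to that side. *)
Lemma progressive_rank :
  progressive (fun a b => kernel a \/ ~ last_stage a b).
Proof.
move=> a b [|nZ].
  rewrite -{1}deriv_kernel => -[s0 [s1 [ss k0 k1]]].
  by exists s0, s1; split=> // t0 t1 _; split; left; left.
have nKb : ~ kernel b by apply: contra_not nZ => /(_ _ (stage_last a)).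
have [h|h] := stage_linear (stage_last b) (stage_last a).
  by case: nZ; apply: h; exact: last_stage_self.
have [s0 [s1 [ss k0 k1]]] := h a (@last_stage_self a).
exists s0, s1; split=> // t0 t1 ts.
have sub s : last_stage b s -> last_stage s `<=` last_stage b.
  by move=> bs; apply: last_stage_sub => //; exact: stage_last.
have [n0|n1] : ~ last_stage b t0 \/ ~ last_stage b t1.
- apply/not_andP => -[b0 b1]; apply: (not_deriv_last_stage nKb).
  by exists t0, t1.
- by split; left; right; apply: contra_not n0; exact: sub.
- by split; right; right; apply: contra_not n1; exact: sub.
Qed.

(** Taking [last_stage a] for [X] shows that [b] cannot last as long as [a] unless [a] is in the
    kernel. *)
Lemma outranks_stage X a b : stage X -> outranks a b -> X b -> deriv X a.
Proof.
move=> sX [R pR]; elim: sX a b => [Y sY IH|F sF IH] a b Rab.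
  move=> [t0 [t1 [ts y0 y1]]]; have [s0 [s1 [ss h]]] := pR a b Rab.
  have [h0 h1] := h t0 t1 ts; exists s0, s1; split=> //.
    by case: h0 => /IH; apply.
  by case: h1 => /IH; apply.
(* Either [b] is not in the derivative of some member [Z], which is then the least one, or [b] is in
   the derivative of every member. In that case the pair [s0], [s1], chosen independently of the
   member, splits [a] in the intersection. *)
move=> Fb; have [[Z FZ nZb]|nZ] := pselect (exists2 Z, F Z & ~ deriv Z b).
  have [h|h] := stage_linear (sF Z FZ) (stage_cap sF).
    have -> : \bigcap_(Y in F) Y = Z.
      by apply/seteqP; split=> // c; apply.
    exact: IH FZ a b Rab (Fb Z FZ).
  by case: nZb; exact: h.
have [s0 [s1 [ss h]]] := pR a b Rab; exists s0, s1.
have dZ Z : F Z -> deriv Z b.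
  by move=> FZ; apply: contrapT => nZb; apply: nZ; exists Z.
split=> // Z FZ; have [t0 [t1 [ts z0 z1]]] := dZ Z FZ;
  have [h0 h1] := h t0 t1 ts; apply: (deriv_sub (sF Z FZ)).
  by case: h0 => /(IH Z FZ); apply.
by case: h1 => /(IH Z FZ); apply.
Qed.

Lemma outranksE a b : outranks a b <-> kernel a \/ ~ last_stage a b.
Proof.
split; last by move=> h; exists (fun a b => kernel a \/ ~ last_stage a b);
  first exact: progressive_rank.
move=> ab; apply/or_asboolP; rewrite -[X in X || _]negbK -implybE.
apply/implyP => /asboolP nK; apply/asboolP => bZ.
apply: (not_deriv_last_stage nK); exact: outranks_stage (stage_last a) ab bZ.
Qed.

(* This is Pi^1_1 in [T]: the closed set fed to the oracle consists of
   witnesses of its negation. *)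
Definition settles (s t : seq nat) : Prop :=
  forall n, exists t', [/\ T t', prefix t t', size t' = size t + n
    & ~ outranks s t'].

Lemma settlesP s : ~ kernel s -> forall t, settles s t <->
  forall n, exists t', [/\ T t', prefix t t', size t' = size t + n
    & last_stage s t'].
Proof.
move=> nK t; split=> h n; have [t' [? ? ? ot']] := h n; exists t'; split=> //.
  by apply: contrapT => nZ; apply: ot'; apply/outranksE; right.
by move/outranksE => -[].
Qed.

Lemma settles_not_kernel s t : settles s t -> ~ kernel s.
Proof. by move=> /(_ 0)[t' [_ _ _ h]] k; apply: h; apply/outranksE; left. Qed.

End Derivative.

(** * Paths settled by a node *)

Lemma mkseq_prefix (x : nat -> nat) m n : m <= n -> prefix (mkseq x m) (mkseq x n).
Proof.
move=> le; rewrite prefixE size_mkseq /mkseq -map_take take_iota.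
by rewrite (minn_idPl le).
Qed.

Section Tree.
Variable T : pred (seq nat).
Hypothesis treeT : is_tree T.

Lemma tree_prefix s t : prefix s t -> T t -> T s.
Proof. exact: treeT.2. Qed.

Lemma tree_nil : T [::].
Proof. by have [[s Ts] h] := treeT; apply: h Ts; exact: prefix0s. Qed.

Lemma kernel_tree a : kernel T a -> T a.
Proof.
rewrite -{1}deriv_kernel => -[s0 [s1 [/and5P[t0 _ a0 _ _] _ _]]].
exact: tree_prefix a0 t0.
Qed.

(** Incompatible nodes would split [s] within [last_stage s], against [not_deriv_last_stage]. *)
Lemma last_stage_chain s t0 t1 : ~ kernel T s -> T t0 -> T t1 ->
  prefix s t0 -> prefix s t1 -> last_stage T s t0 -> last_stage T s t1 ->
  size t0 <= size t1 -> prefix t0 t1.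
Proof.
move=> nK T0 T1 p0 p1 l0 l1 le; apply: contrapT => n01.
apply: (not_deriv_last_stage nK); exists t0, t1; split=> //.
rewrite /splits T0 T1 p0 p1 /=; apply/andP; split; first exact/negP.
apply: contra_notN n01 => p10; have le' := size_prefix p10.
have E : size t1 = size t0 by apply/eqP; rewrite eqn_leq le le'.
by move: p10; rewrite prefixE E take_size => /eqP ->; exact: prefix_refl.
Qed.

(** By [last_stage_chain] the witnesses [f n] of [settles T s s] form a chain, whose union is [x].
    Any [t] above [s] with [settles T s t] fits into the same chain. *)
Lemma settled_path s : settles T s s -> exists x : baire,
  [/\ paths T x, mkseq x (size s) = s &
    forall t, prefix s t -> (settles T s t <-> t = mkseq x (size t))].
Proof.
move=> ss; have nK := settles_not_kernel ss.
have /choice[f hf] := (settlesP nK s).1 ss.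
(* [f i.+1] has length at least [i.+1], so the default is never read. *)
pose x : baire := fun i => nth 0 (f i.+1) i.
have szf n : size (f n) = size s + n by have [] := hf n.
have ff m n : m <= n -> prefix (f m) (f n).
  move=> le; have [Tm sm _ lm] := hf m; have [Tn sn _ ln] := hf n.
  by apply: (@last_stage_chain s) => //; rewrite !szf leq_add2l.
have xf n m : n <= size (f m) -> mkseq x n = take n (f m).
  move=> le; apply: (@eq_from_nth _ 0).
    by rewrite size_mkseq size_takel.
  rewrite size_mkseq => i lt; rewrite nth_mkseq // nth_take //.
  have [le'|/ltnW le'] := leqP i.+1 m; have /prefixP[u E] := ff _ _ le'.
    by rewrite /x E nth_cat szf ifT //; lia.
  by rewrite /x E nth_cat ifT //; lia.
have xs n : mkseq x (size s + n) = f n.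
  by rewrite (xf _ n) ?szf // -szf take_size.
have pathx n : T (mkseq x n).
  have [Tn _ _ _] := hf n; rewrite (xf n n) ?szf ?leq_addl //.
  by apply: tree_prefix Tn; exact: prefix_take.
have xs0 : mkseq x (size s) = s.
  have [_ p _ _] := hf 0; rewrite (xf _ 0) ?szf ?addn0 //.
  by move: p; rewrite prefixE => /eqP.
exists x; split=> // t st; split=> [/(settlesP nK t)/(_ 0)[t' [Tt' tt' sz lt']]|E].
  have le := size_prefix st.
  have [Tn sn _ ln] := hf (size t - size s).
  have : prefix t' (f (size t - size s)).
    apply: (@last_stage_chain s) => //; first exact: prefix_trans st tt'.
    by rewrite szf subnKC // sz addn0.
  rewrite addn0 in sz.
  have -> : t' = t by move: tt'; rewrite prefixE -sz take_size => /eqP.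
  rewrite -xs prefixE => /eqP; rewrite subnKC // take_oversize ?size_mkseq //.
apply/(settlesP nK) => n.
have le := size_prefix st; have [Tn sn _ ln] := hf (size t - size s + n).
exists (f (size t - size s + n)); split=> //; last by rewrite szf addnA subnKC.
by rewrite {1}E -xs addnA subnKC //; apply: mkseq_prefix; exact: leq_addr.
Qed.

(** Let [Z] be the least stage containing all initial segments of [x]. One of them is outside
    [deriv Z], or [Z] would lie in the kernel. By linearity the last stage of that one includes [Z],
    hence all initial segments. *)
Lemma settles_exists (x : baire) n : paths T x -> ~ kernel T (mkseq x n) ->
  exists m, forall i, settles T (mkseq x m) (mkseq x (m + i)).
Proof.
move=> Tx nK.
pose F := [set X | stage T X /\ forall i, X (mkseq x i)].
pose Z := \bigcap_(X in F) X.
have sZ : stage T Z by apply: stage_cap => X [].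
have Zx i : Z (mkseq x i) by move=> X [_]; exact.
have [m dm] : exists m, ~ deriv T Z (mkseq x m).
  apply/existsNP => h; apply: nK.
  apply: (@post_fixpoint_kernel T Z) => //.
  by move=> a; apply; split=> //; exact: stage_deriv.
have nKm : ~ kernel T (mkseq x m).
  by apply: contra_not dm => k; rewrite -deriv_kernel in k;
     apply: deriv_mono k => a; exact.
exists m => i; apply/(settlesP nKm) => j.
exists (mkseq x (m + i + j)); split=> //.
- by apply: mkseq_prefix; exact: leq_addr.
- by rewrite !size_mkseq.
- have [h|h] := stage_linear sZ (stage_last T (mkseq x m)); first exact: h.
  by case: dm; apply: h; exact: last_stage_self.
Qed.

(** Stated through [settles] because that is what the reductions enumerate; [perfect_partE] gives
    the paths through the kernel. *)
Definition perfect_part : set baire :=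
  [set x | paths T x /\ forall n, ~ settles T (mkseq x n) (mkseq x n)].

Lemma perfect_partE : perfect_part = [set x | forall n, kernel T (mkseq x n)].
Proof.
apply/seteqP; split=> x.
  move=> [Tx h] n; apply: contrapT => nK; have [m hm] := settles_exists Tx nK.
  by apply: (h m); have := hm 0; rewrite addn0.
move=> h; split=> n; first exact: kernel_tree.
by move/settles_not_kernel; apply.
Qed.

Lemma scattered_settled (x : baire) : paths T x -> ~ perfect_part x ->
  exists2 s, settles T s s &
    forall t, prefix s t -> (settles T s t <-> t = mkseq x (size t)).
Proof.
move=> Tx; rewrite perfect_partE => /existsNP[n nK].
have [m hm] := settles_exists Tx nK.
have ss : settles T (mkseq x m) (mkseq x m) by have := hm 0; rewrite addn0.
exists (mkseq x m) => //; have [y [Ty ys hy]] := settled_path ss.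
(* The initial segments of [x] from length [m] on are settled, so they also lie on [y]. *)
suff -> : x = y by rewrite size_mkseq in ys; rewrite ys.
apply/funext => i; have := (hy _ (mkseq_prefix x (leq_addr i.+1 m))).1 (hm i.+1).
rewrite size_mkseq => /(congr1 (nth 0 ^~ i)).
by rewrite !nth_mkseq // addnS ltnS leq_addl.
Qed.

Lemma settled_scattered s : settles T s s -> exists x : baire,
  [/\ paths T x, ~ perfect_part x &
    forall t, prefix s t -> (settles T s t <-> t = mkseq x (size t))].
Proof.
move=> ss; have [x [Tx xs hx]] := settled_path ss; exists x; split=> //.
by move=> [_ /(_ (size s))]; rewrite xs.
Qed.

End Tree.

(** * Perfect kernels in Baire space *)

Lemma eq_mkseqP (x y : nat -> nat) n :
  mkseq x n = mkseq y n <-> forall i, i < n -> x i = y i.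
Proof.
split=> [E i lt|h]; last first.
  by apply/eq_in_map => i; rewrite mem_iota; exact: h.
by have := congr1 (nth 0 ^~ i) E; rewrite !nth_mkseq.
Qed.

Lemma nbhs_cylinder (x : baire) n :
  nbhs x [set y : baire | mkseq y n = mkseq x n].
Proof.
elim: n => [|n IH]; first exact: filterS filterT.
have hn : nbhs x [set y : baire | y n = x n].
  apply: (@proj_continuous nat (fun=> nat) n x [set k | k = x n]).
  by rewrite nbhs_principalE.
apply: filterS (filterI IH hn) => y [/eq_mkseqP h yn].
apply/eq_mkseqP => i; rewrite ltnS leq_eqVlt => /orP[/eqP ->|] //.
exact: h.
Qed.

(** If no cylinder around [x] fits into [U], points chosen outside [U] in ever smaller cylinders
    converge to [x]. *)
Lemma nbhs_cylinderP (x : baire) (U : set baire) :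
  nbhs x U <-> exists n, [set y : baire | mkseq y n = mkseq x n] `<=` U.
Proof.
split=> [Ux|[n sub]]; last by apply: filterS sub _; exact: nbhs_cylinder.
apply: contrapT => nU.
have /choice[y hy] : forall n, exists y : baire, mkseq y n = mkseq x n /\ ~ U y.
  move=> n; apply: contrapT => h; apply: nU; exists n => y yx.
  by apply: contrapT => Uy; apply: h; exists y.
have : y @ \oo --> x.
  apply/pointwise_cvgP => i; apply: cvg_near_cst.
  exists i.+1 => // n /= lt; have [/eq_mkseqP h _] := hy n; exact: h.
move=> /(_ U Ux) [N _ h]; have [_] := hy N; apply; exact: (h N (leqnn N)).
Qed.

Lemma closed_cylinderP (C : set baire) : closed C <->
  forall x, (forall n, exists2 y, C y & mkseq y n = mkseq x n) -> C x.
Proof.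
split=> [cC x h|h x cx].
  apply: cC => U /nbhs_cylinderP[n sub]; have [y Cy yx] := h n.
  by exists y; split=> //; exact: sub.
apply: h => n; have [y [Cy yx]] := cx _ (nbhs_cylinder x n).
by exists y.
Qed.

Lemma limit_pointP (C : set baire) x : limit_point C x <->
  forall n, exists y, [/\ y <> x, C y & mkseq y n = mkseq x n].
Proof.
split=> [h n|h U /nbhs_cylinderP[n sub]].
  by have [y [/eqP ne Cy yx]] := h _ (nbhs_cylinder x n); exists y.
by have [y [ne Cy yx]] := h n; exists y; split=> //; [exact/eqP|exact: sub].
Qed.

Lemma paths_closed T : closed (paths T).
Proof.
by apply/closed_cylinderP => x h n; have [y Ty <-] := h n; exact: Ty.
Qed.

Lemma pruned_path (Q : set (seq nat)) a :
  (forall s t, prefix s t -> Q t -> Q s) ->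
  (forall s, Q s -> exists2 t, Q t & prefix s t && (size s < size t)) ->
  Q a -> exists x : baire, mkseq x (size a) = a /\ forall n, Q (mkseq x n).
Proof.
move=> preQ ext Qa.
have /choice[f hf] : forall s, exists t, Q s -> Q t /\ prefix s t && (size s < size t).
  by move=> s; have [/ext[t Qt h]|nQ] := pselect (Q s); [exists t|exists s].
pose b n := iter n f a.
have Qb n : Q (b n) by elim: n => [|n IH] //=; have [] := hf _ IH.
have b1 n : prefix (b n) (b n.+1) && (size (b n) < size (b n.+1)).
  by have [_] := hf _ (Qb n).
have bb m n : prefix (b m) (b (m + n)).
  elim: n => [|n IH]; first by rewrite addn0 prefix_refl.
  by rewrite addnS; apply: prefix_trans IH _; have /andP[] := b1 (m + n).
have sb n : n <= size (b n).
  by elim: n => // n IH; apply: leq_ltn_trans IH _; have /andP[] := b1 n.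
pose x : baire := fun i => nth 0 (b i.+1) i.
have xb n : mkseq x (size (b n)) = b n.
  apply: (@eq_from_nth _ 0); rewrite size_mkseq // => i lt.
  rewrite nth_mkseq // /x; have lt' := sb i.+1.
  have [le|/ltnW le] := leqP i.+1 n.
    by have := bb i.+1 (n - i.+1); rewrite subnKC // => /prefixP[u ->];
      rewrite nth_cat lt'.
  by have := bb n (i.+1 - n); rewrite subnKC // => /prefixP[u ->];
    rewrite nth_cat lt.
exists x; split=> [|n]; first exact: (xb 0).
by apply: preQ (Qb n); rewrite -xb; exact: mkseq_prefix.
Qed.

Section PerfectKernel.
Variable T : pred (seq nat).
Hypothesis treeT : is_tree T.

Lemma kernel_path a : kernel T a ->
  exists2 x, perfect_part T x & mkseq x (size a) = a.
Proof.
move=> Ka; have [|s|x [xa Kx]] := pruned_path _ _ Ka.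
- by move=> s t; apply: stage_prefix; exact: stage_kernel.
- rewrite -{1}deriv_kernel => -[s0 [s1 [/and5P[_ _ p0 p1 /andP[n01 n10]] k0 k1]]].
  (* [s0] is a proper extension: were it [s] itself, it would be a prefix of [s1]. *)
  exists s0; rewrite // p0 /= ltn_neqAle size_prefix // andbT.
  apply: contra n01 => /eqP sz; move: p0; rewrite prefixE sz take_size.
  by move=> /eqP ->.
- by exists x => //; rewrite perfect_partE.
Qed.

(** Two incompatible extensions in the kernel lead to two different points, at most one of which is
    [x], so no point is isolated. The remaining paths are countable because each is determined by a
    node that settles itself. *)
Lemma perfect_part_kernel : is_perfect_kernel (paths T) (perfect_part T).
Proof.
have closedP : closed (perfect_part T).
  rewrite perfect_partE //; apply/closed_cylinderP => x h n.
  by have [y Ky <-] := h n; exact: Ky.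
split.
- split=> //; apply/seteqP; split=> x.
    move=> /limit_pointP h; apply: ((closed_cylinderP _).1 closedP) => n.
    by have [y [_ Py yx]] := h n; exists y.
  move=> Px; apply/limit_pointP => n.
  have : kernel T (mkseq x n) by move: Px n; rewrite perfect_partE.
  rewrite -{1}deriv_kernel => -[s0 [s1 [/and5P[_ _ p0 p1 /andP[n01 n10]] k0 k1]]].
  have [y0 P0 y0s] := kernel_path k0; have [y1 P1 y1s] := kernel_path k1.
  have agree (y : baire) s : prefix (mkseq x n) s -> mkseq y (size s) = s ->
      mkseq y n = mkseq x n.
    move=> xs ys; have := size_prefix xs; rewrite size_mkseq => le.
    have := mkseq_prefix y le; rewrite ys => /[dup]; move: xs.
    by rewrite !prefixE !size_mkseq => /eqP -> /eqP.
  have [E|ne] := pselect (y0 = x); last first.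
    by exists y0; split=> //; exact: agree y0s.
  exists y1; split=> //; last exact: agree y1s.
  move=> E1; have {}E1 : y1 = y0 by rewrite E1.
  have [le|/ltnW le] := leqP (size s0) (size s1).
    by move: n01; rewrite -y0s -y1s E1 mkseq_prefix.
  by move: n10; rewrite -y0s -y1s E1 mkseq_prefix.
- by move=> x [].
- have /choice[f hf] : forall x, exists s, paths T x -> ~ perfect_part T x ->
      settles T s s /\
      forall t, prefix s t -> (settles T s t <-> t = mkseq x (size t)).
    move=> x; have [[Tx nP]|h] := pselect (paths T x /\ ~ perfect_part T x).
      by have [s ss hs] := scattered_settled treeT Tx nP; exists s.
    by exists [::] => Tx nP; case: h.
  apply/countable_injP; exists (CodeSeq.code \o f) => x y.
  rewrite !inE => -[Tx nPx] [Ty nPy] /= /(can_inj CodeSeq.codeK) fxy.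
  have [sx hx] := hf _ Tx nPx; have [_ hy] := hf _ Ty nPy; rewrite -fxy in hy.
  apply/funext => i; pose t := mkseq x (size (f x) + i.+1).
  have st : prefix (f x) t.
    by rewrite (hx _ (prefix_refl _)).1 // mkseq_prefix // leq_addr.
  have : settles T (f x) t by apply/hx => //; rewrite size_mkseq.
  move=> /(hy _ st) /(congr1 (nth 0 ^~ i)); rewrite size_mkseq.
  by rewrite !nth_mkseq // addnS ltnS leq_addl.
Qed.

End PerfectKernel.

(** * Points inside and outside a perfect kernel *)

Lemma not_countable_cantor (X : Type) (f : (nat -> bool) -> X) (A : set X) :
  injective f -> (forall g, A (f g)) -> ~ countable A.
Proof.
move=> finj fA /countable_injP[c cinj].
have cfinj g h : c (f g) = c (f h) -> g = h.
  by move=> E; apply/finj/cinj; rewrite ?inE.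
(* Cantor's diagonal: [g] differs from each [h] at the code of [f h]. *)
pose g n := `[< exists2 h : nat -> bool, c (f h) = n & ~~ h n >].
have [gn|gn] := boolP (g (c (f g))).
  by have /asboolP[h /cfinj -> /negP] := gn; apply.
by move: (gn) => /asboolP; apply; exists g.
Qed.

(** If [P] missed a cylinder around [x], the part of [A] in it would lie in the countable scattered
    part. *)
Lemma condensation_point (A P : set baire) x : is_perfect_kernel A P ->
  (forall n, ~ countable (A `&` [set y | mkseq y n = mkseq x n])) -> P x.
Proof.
move=> [[cP _] PA cnt] h; apply: (closed_cylinderP P).1 => // n.
apply: contrapT => nP; apply: (h n); apply: sub_countable cnt.
apply: subset_card_le => y [Ay yx]; split=> // Py.
by apply: nP; exists y.
Qed.

Lemma isolated_point (A P : set baire) x n : is_perfect_kernel A P ->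
  (forall y, A y -> mkseq y n = mkseq x n -> y = x) -> ~ P x.
Proof.
move=> [[_ lP] PA _] h; rewrite -{1}lP => /limit_pointP/(_ n)[y [ne Py yx]].
by apply: ne; apply: h => //; exact: PA.
Qed.

(** * The tree of witnesses *)

Section WitnessTree.
Variable T : pred (seq nat).

(* A point [z] of [paths witness_tree] has the following form. Its first value
   codes a pair of nodes [s], [t]. The first position [n > 0] with a nonzero
   value, if any, is a marker, and then [z] describes a proof that [~ settles s t]:
   [z n - 1] is the length by which [t] is extended, and the values
   at the positions [enc [:: n; a; b]] are [0] where the progressive relation
   does not hold and code the splitting of [a] where it does. Infinitely many
   other positions are free, so no point with a marker is isolated. *)
Definition entry (c i : nat) : nat := nth 0 (dec c) i.

(* Reading missing values as nonzero keeps the constraint from failing before all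
   of its positions are known, so that [witness_tree] is closed under prefixes. *)
Definition related (u : seq nat) (n a b : nat) : bool :=
  nth 1 u (enc [:: n; a; b]) != 0.

Definition root_ok (u : seq nat) (n c : nat) : bool :=
  [&& T (dec c), prefix (dec (entry (nth 0 u 0) 1)) (dec c) &
      (size (dec c)).+1 == size (dec (entry (nth 0 u 0) 1)) + nth 0 u n]
  ==> related u n (entry (nth 0 u 0) 0) c.

Definition step_ok (u : seq nat) (n a b t0 t1 v : nat) : bool :=
  (v != 0) ==>
  splits T (dec a) (dec (entry v 0)) (dec (entry v 1)) &&
  (splits T (dec b) (dec t0) (dec t1) ==>
     (related u n (entry v 0) t0 || related u n (entry v 0) t1) &&
     (related u n (entry v 1) t0 || related u n (entry v 1) t1)).

Definition is_marker (u : seq nat) (n : nat) : bool :=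
  [&& 0 < n, nth 0 u n != 0 &
      all (fun i => (i == 0) || (nth 0 u i == 0)) (iota 0 n)].

(** The number [c] is read both as a node and as a quadruple of nodes, so one bounded quantifier
    reaches all instances of both constraints as [u] grows. *)
Definition marker_ok (u : seq nat) (n : nat) : bool :=
  all (fun c => root_ok u n c &&
    step_ok u n (entry c 0) (entry c 1) (entry c 2) (entry c 3)
      (nth 0 u (enc [:: n; entry c 0; entry c 1])))
    (iota 0 (size u)).

Definition witness_tree (u : seq nat) : bool :=
  all (fun n => is_marker u n ==> marker_ok u n) (iota 0 (size u)).

Definition marker (z : nat -> nat) (n : nat) : Prop :=
  [/\ 0 < n, z n != 0 & forall i, 0 < i < n -> z i = 0].

Definition root_holds (z : nat -> nat) (n : nat) : Prop :=
  forall t', T t' -> prefix (dec (entry (z 0) 1)) t' ->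
    (size t').+1 = size (dec (entry (z 0) 1)) + z n ->
    z (enc [:: n; entry (z 0) 0; enc t']) != 0.

Definition step_holds (z : nat -> nat) (n : nat) : Prop :=
  forall a b, let v := z (enc [:: n; enc a; enc b]) in v != 0 ->
    splits T a (dec (entry v 0)) (dec (entry v 1)) /\
    forall t0 t1, splits T b t0 t1 ->
      let rel a b := z (enc [:: n; a; enc b]) != 0 in
      (rel (entry v 0) t0 \/ rel (entry v 0) t1) /\
      (rel (entry v 1) t0 \/ rel (entry v 1) t1).

Lemma related_cat u w n a b : related (u ++ w) n a b -> related u n a b.
Proof.
rewrite /related nth_cat; case: ltnP => // le _.
by rewrite nth_default.
Qed.

Lemma witness_tree_is_tree : is_tree witness_tree.
Proof.
split; first by exists [::].
move=> u t /prefixP[w ->{t}] /allP h; apply/allP => n.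
rewrite mem_iota => /= lt; apply/implyP => mk.
have eqn i : i < size u -> nth 0 (u ++ w) i = nth 0 u i.
  by move=> lt'; rewrite nth_cat lt'.
have eq0 : nth 0 (u ++ w) 0 = nth 0 u 0 by apply: eqn; exact: leq_ltn_trans lt.
have mem i : i < size u -> i \in iota 0 (size (u ++ w)).
  by move=> lti; rewrite mem_iota add0n size_cat ltn_addr.
have /implyP hn := h n (mem n lt).
have /allP {}hn : marker_ok (u ++ w) n.
  apply: hn; move: mk => /and3P[n0 un /allP ui]; apply/and3P; split=> //.
    by rewrite eqn.
  apply/allP => i /[dup] + /ui; rewrite mem_iota => /= ltn.
  by rewrite eqn // (ltn_trans ltn).
apply/allP => c; rewrite mem_iota => /= ltc.
have /andP[hr hs] := hn c (mem c ltc); apply/andP; split.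
  apply/implyP => tc; apply: (@related_cat _ w); move: hr.
  by rewrite /root_ok eq0 eqn // => /implyP; apply.
(* A position not yet reached reads as 0 here, which falsifies the premise of [step_ok]. *)
set k := enc _ in hs *; case: (ltnP k (size u)) => [ltk|lek]; last first.
  by rewrite /step_ok nth_default.
rewrite eqn // in hs; apply/implyP => v0; move/implyP: hs => /(_ v0).
move=> /andP[-> /implyP hs]; apply/implyP => /hs.
by move=> /andP[/orP[]/related_cat -> /orP[]/related_cat ->]; rewrite ?orbT.
Qed.

Lemma is_markerP (z : nat -> nat) n m : n < m ->
  reflect (marker z n) (is_marker (mkseq z m) n).
Proof.
move=> lt; rewrite /is_marker nth_mkseq //.
apply: (iffP and3P) => -[n0 zn h]; split=> //.
  move=> i /andP[i0 lti]; have /allP/(_ i) := h; rewrite mem_iota => /(_ lti).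
  by rewrite nth_mkseq ?(ltn_trans lti) // eqn0Ngt i0 => /eqP.
apply/allP => i; rewrite mem_iota => /= lti.
rewrite nth_mkseq ?(ltn_trans lti) //.
by have [//|i0] := eqVneq i 0; rewrite h // lt0n i0.
Qed.

(** Each instance of a constraint reads finitely many positions, so it is enforced once an initial
    segment covers them; before that, unread positions only weaken it. *)
Lemma paths_witness_tree (z : baire) : paths witness_tree z <->
  forall n, marker z n -> root_holds z n /\ step_holds z n.
Proof.
split=> [hz n mz|h m].
  have hm m c : n < m -> c < m -> root_ok (mkseq z m) n c /\
      step_ok (mkseq z m) n (entry c 0) (entry c 1) (entry c 2) (entry c 3)
      (nth 0 (mkseq z m) (enc [:: n; entry c 0; entry c 1])).
    move=> ltn ltc; have /allP/(_ n) := hz m.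
    rewrite mem_iota size_mkseq => /(_ ltn)/implyP.
    move=> /(_ (introT (is_markerP z ltn) mz))/allP/(_ c).
    by rewrite mem_iota size_mkseq => /(_ ltc)/andP[].
  split=> [t' Tt' pt' sz|a b v v0].
    pose k := enc [:: n; entry (z 0) 0; enc t'].
    have [||+ _] := hm (n + enc t' + k).+1 (enc t'); try lia.
    rewrite /root_ok /related !nth_mkseq; try lia.
    by rewrite CodeSeq.codeK Tt' pt' sz eqxx.
  have hv t0 t1 : let w := [:: enc a; enc b; enc t0; enc t1] in
      let k := enc [:: n; enc a; enc b] in
      forall m, n + enc w + k < m ->
        step_ok (mkseq z m) n (enc a) (enc b) (enc t0) (enc t1) v.
    move=> w k m ltm; have [||_] := hm m (enc w); try lia.
    have ltk : k < m by lia.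
    by rewrite /entry CodeSeq.codeK /= nth_mkseq.
  split.
    have /implyP/(_ v0) := hv [::] [::] _ (ltnSn _).
    by rewrite !CodeSeq.codeK => /andP[].
  move=> t0 t1 ts rel.
  pose k i t := enc [:: n; entry v i; enc t].
  pose N := (n + enc [:: enc a; enc b; enc t0; enc t1] + enc [:: n; enc a; enc b]
    + k 0 t0 + k 0 t1 + k 1 t0 + k 1 t1).+1.
  have /implyP/(_ v0) := hv t0 t1 N ltac:(rewrite /N; lia).
  rewrite !CodeSeq.codeK => /andP[_ /implyP/(_ ts)].
  rewrite /related -/N !nth_mkseq; try by rewrite -/(k _ _) /N; lia.
  by move=> /andP[/orP h0 /orP h1].
apply/allP => n; rewrite mem_iota size_mkseq => /= ltn; apply/implyP.
move=> /(is_markerP z ltn) mz; have [hr hs] := h n mz.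
have rel a b : z (enc [:: n; a; b]) != 0 -> related (mkseq z m) n a b.
  move=> z0; rewrite /related; set k := enc _ in z0 *.
  by case: (ltnP k m) => lt; [rewrite nth_mkseq|rewrite nth_default ?size_mkseq].
apply/allP => c; rewrite mem_iota size_mkseq add0n => /andP[_ ltc].
apply/andP; split.
  apply/implyP; rewrite !nth_mkseq ?(leq_ltn_trans _ ltn) //.
  move=> /and3P[Tc pc /eqP sz]; apply: rel.
  by rewrite -[c]CodeSeq.decodeK; exact: hr.
apply/implyP; set k := enc _; case: (ltnP k m) => lt; last first.
  by rewrite nth_default ?size_mkseq.
rewrite nth_mkseq //; have := hs (dec (entry c 0)) (dec (entry c 1)).
rewrite !CodeSeq.decodeK -/k => + v0 => /(_ v0)[-> hst]; apply/implyP => ts.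
have [] := hst _ _ ts; rewrite !CodeSeq.decodeK => h0 h1.
by apply/andP; split; apply/orP; [case: h0|case: h1] => /rel; [left|right|left|right].
Qed.

Definition settled_code (m : nat) : Prop :=
  settles T (dec (entry m 0)) (dec (entry m 1)).

(** The nonzero entries of [z] form a progressive relation from the first node to every extension in
    [T] of the second by [(z n).-1]. *)
Lemma marker_unsettled (z : baire) n :
  paths witness_tree z -> marker z n -> ~ settled_code (z 0).
Proof.
move=> /paths_witness_tree/(_ n) h mz; have [hr hs] := h mz.
have [_ zn0 _] := mz.
move=> /(_ (z n).-1)[t' [Tt' pt' sz]]; apply.
exists (fun a b => z (enc [:: n; enc a; enc b]) != 0); last first.
  rewrite CodeSeq.decodeK; apply: hr => //; rewrite sz.
  by move: zn0; case: (z n) => // k _; rewrite addnS.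
move=> a b ab; have [ss hst] := hs a b ab.
by do 2 eexists; split; [exact: ss|move=> t0 t1 /hst; rewrite !CodeSeq.decodeK].
Qed.

Lemma marker_inj (z : nat -> nat) m n : marker z m -> marker z n -> m = n.
Proof.
move=> [m0 zm hm] [n0 zn hn]; case: (ltngtP m n) => // lt.
  by move: zm; rewrite hn // m0.
by move: zn; rewrite hm // n0.
Qed.

(** The relation encoded after the marker is [outranks] itself, with splittings from
    [progressive_outranks]. *)
Lemma unsettled_witness m n : ~ settled_code m -> 0 < n ->
  exists z : baire, [/\ paths witness_tree z, marker z n & z 0 = m].
Proof.
set s := dec (entry m 0); set t := dec (entry m 1) => uns n0.
have [N hN] : exists N, forall t', T t' -> prefix t t' -> size t' = size t + N ->
    outranks T s t'.
  apply: contrapT => h; apply: uns => N; apply: contrapT => h'.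
  apply: h; exists N => t' Tt' pt' sz; apply: contrapT => no; apply: h'.
  by exists t'.
have /choice[f hf] : forall ab : seq nat * seq nat, exists v : nat,
    (outranks T ab.1 ab.2 -> v != 0) /\
    (v != 0 -> splits T ab.1 (dec (entry v 0)) (dec (entry v 1)) /\
     forall t0 t1, splits T ab.2 t0 t1 ->
      let rel i t := outranks T (dec (entry v i)) t in
      (rel 0 t0 \/ rel 0 t1) /\ (rel 1 t0 \/ rel 1 t1)).
  move=> [a b] /=; have [ab|nab] := pselect (outranks T a b); last by exists 0.
  have [s0 [s1 [ss h]]] := progressive_outranks ab.
  exists (enc [:: enc s0; enc s1]).
  have e0 : entry (enc [:: enc s0; enc s1]) 0 = enc s0.
    by rewrite /entry CodeSeq.codeK.
  have e1 : entry (enc [:: enc s0; enc s1]) 1 = enc s1.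
    by rewrite /entry CodeSeq.codeK.
  rewrite e0 e1 !CodeSeq.codeK; split=> // _.
  by rewrite -lt0n (leq_ltn_trans (leq0n (enc s0))) // ltn_code_mem // mem_head.
(* Codes of triples starting with [n] exceed [n], so the relation does not collide with the zeros or
   the marker. *)
pose z : baire := fun i => if i == 0 then m else if i < n then 0
  else if i == n then N.+1
  else if dec i is [:: n'; a; b] then if n' == n then f (dec a, dec b) else 0 else 0.
have z0 : z 0 = m by [].
have zn : z n = N.+1 by rewrite /z ltnn eqxx gtn_eqF.
have zf a b : z (enc [:: n; a; b]) = f (dec a, dec b).
  have := @ltn_code_mem [:: n; a; b] n (mem_head _ _); set k := enc _ => lt.
  rewrite /z gtn_eqF ?(leq_ltn_trans _ lt) // ltnNge (ltnW lt) /= gtn_eqF //.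
  by rewrite /k CodeSeq.codeK eqxx.
have mz : marker z n.
  split=> //; first by rewrite zn.
  by move=> i /andP[i0 lt]; rewrite /z gtn_eqF // lt.
exists z; split=> //; apply/paths_witness_tree => n' /(marker_inj mz) <-{n'}.
split.
  rewrite /root_holds z0 zn -/t addnS => t' Tt' pt' [sz].
  rewrite zf CodeSeq.codeK.
  by apply: (hf (s, t')).1; exact: hN.
move=> a b; rewrite zf !CodeSeq.codeK => v v0; have [ss h] := (hf (a, b)).2 v0.
split=> // t0 t1 /h [h0 h1] rel.
have relP i t' : outranks T (dec (entry v i)) t' -> rel (entry v i) t'.
  by move=> o; rewrite /rel zf CodeSeq.codeK; exact: (hf (_, _)).1.
by split; [case: h0|case: h1] => /relP; [left|right|left|right].
Qed.

(** Apart from the positions up to [n], the constraints read only codes of triples, so codes of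
    pairs are free. The shift by [L] protects the first [L] values and puts a copy of Cantor space
    into every cylinder around a marked path. *)
Definition vary (z : baire) (n L : nat) (g : nat -> bool) : baire := fun i =>
  if dec i is [:: n'; k] then
    if (n' == n) && (L <= k) then nat_of_bool (g (k - L)) else z i
  else z i.

Lemma vary_inj z n L : injective (vary z n L).
Proof.
move=> g h /(congr1 (fun x : baire => fun k => x (enc [:: n; L + k]))) E.
apply/funext => k; have := congr1 (@^~ k) E.
by rewrite /vary CodeSeq.codeK eqxx leq_addr addKn; case: (g k); case: (h k).
Qed.

Lemma vary_below z n L g i : (i <= n) || (i < L) -> vary z n L g i = z i.
Proof.
move=> lt; rewrite /vary; case E: (dec i) => [|n' [|k [|? ?]]] //.
have Ei : i = enc [:: n'; k] by rewrite -E CodeSeq.decodeK.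
have lt1 : n' < i by rewrite Ei ltn_code_mem // mem_head.
have lt2 : k < i by rewrite Ei ltn_code_mem // !inE eqxx orbT.
by case: eqP => //= En; case: leqP => //= le; lia.
Qed.

Lemma vary_triple z n L g a b c :
  vary z n L g (enc [:: a; b; c]) = z (enc [:: a; b; c]).
Proof. by rewrite /vary CodeSeq.codeK. Qed.

Lemma vary_path z n L g : paths witness_tree z -> marker z n ->
  paths witness_tree (vary z n L g).
Proof.
move=> /paths_witness_tree/(_ n) hz mz; have [hr hs] := hz mz.
have [n0 zn h] := mz.
have E0 : vary z n L g 0 = z 0 by rewrite vary_below.
have En : vary z n L g n = z n by rewrite vary_below // leqnn.
have mv : marker (vary z n L g) n.
  split=> //; first by rewrite En.
  by move=> i /andP[i0 lt]; rewrite vary_below ?(ltnW lt) // h // i0.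
apply/paths_witness_tree => m /(marker_inj mv) <-{m}; split.
  by rewrite /root_holds E0 En => t' *; rewrite vary_triple; exact: hr.
move=> a b; rewrite vary_triple => v v0; have [ss h2] := hs a b v0.
by split=> // t0 t1 /h2; rewrite /= !vary_triple.
Qed.

Definition spike (m : nat) : baire := fun i => if i == 0 then m else 0.

Lemma no_marker_spike (z : baire) : (forall n, ~ marker z n) -> z = spike (z 0).
Proof.
move=> h; apply/funext => i; rewrite /spike; case: eqP => [->//|/eqP i0].
apply: contrapT => /eqP zi.
have ex : exists i, (i != 0) && (z i != 0) by exists i; rewrite i0.
case: (ex_minnP ex) => n /andP[n0 zn] min; apply: (h n); split=> //.
  by rewrite lt0n.
move=> j /andP[j0 lt]; apply/eqP; apply: contraTT lt => zj.
by rewrite -leqNgt min // -lt0n j0.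
Qed.

Lemma spike_marker m n : ~ marker (spike m) n.
Proof. by move=> [n0 + _]; rewrite /spike; case: n n0. Qed.

(** Paths with a marker are condensation points by [vary]. If [m] is not settled, [spike m] is a
    limit of them, with markers ever farther out. If [m] is settled, no path starting with [m] has a
    marker, so [spike m] is isolated. *)
Lemma witness_kernel (P : set baire) : is_perfect_kernel (paths witness_tree) P ->
  forall x, paths witness_tree x /\ ~ P x <-> settled_code (x 0) /\ x = spike (x 0).
Proof.
move=> kP x.
have marked z n : paths witness_tree z -> marker z n -> P z.
  move=> hz mz; apply: condensation_point kP _ => L.
  apply: (@not_countable_cantor _ (vary z n L)); first exact: vary_inj.
  move=> g; split; first exact: vary_path.
  by apply/eq_mkseqP => i lt; rewrite vary_below // lt orbT.
split=> [[hx nPx]|[sx ->]].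
  have xE : x = spike (x 0).
    by apply: no_marker_spike => n mx; apply: nPx; exact: marked mx.
  split=> //; apply: contrapT => uns; apply: nPx.
  have [[cP _] _ _] := kP; apply: (closed_cylinderP P).1 => // n.
  have [z [hz mz z0]] := unsettled_witness uns (ltn0Sn n).
  exists z; first exact: marked mz.
  apply/eq_mkseqP => i lt; rewrite xE /spike; case: eqP => [->//|/eqP i0].
  by have [_ _ ->] := mz; rewrite // lt0n i0 (leqW lt).
split; first by apply/paths_witness_tree => n /spike_marker.
apply: (isolated_point (n := 1) kP) => y hy /eq_mkseqP/(_ 0 isT) y0.
have -> : y = spike (y 0).
  apply: no_marker_spike => n my; apply: (marker_unsettled hy my).
  by rewrite y0.
by rewrite y0.
Qed.

End WitnessTree.

(** * The reductions *)

Local Arguments CodeSeq.code : simpl never.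

Lemma entry_code s i : entry (enc s) i = nth 0 s i.
Proof. by rewrite /entry CodeSeq.codeK. Qed.

Definition tree_of (p : baire) : pred (seq nat) := fun s => p (enc s) != 0.

Lemma rcomp_entry k F G : rcomp k F -> rcomp k G ->
  rcomp k (fun p e => entry (F p e) (G p e)).
Proof. exact: rcomp_nth. Qed.

Lemma rcomp_tree_of k F : rcomp k F ->
  rcomp k (fun p e => tree_of p (dec (F p e))).
Proof.
move=> hF; apply: (@rcomp_ext _ (fun p e => ~~ (p (F p e) == 0))).
  by move=> p e; rewrite /tree_of CodeSeq.decodeK.
by apply: rcomp_neg; apply: rcomp_eq0; exact: rcomp_oracle.
Qed.

Lemma rcomp_related k U N A B :
  rcomp k U -> rcomp k N -> rcomp k A -> rcomp k B ->
  rcomp k (fun p e => related (dec (U p e)) (N p e) (A p e) (B p e)).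
Proof.
move=> hU hN hA hB; pose K p e := enc [:: N p e; A p e; B p e].
have hK : rcomp k K by do 3 apply: rcomp_code_cons => //; exact: rcomp_code_nil.
apply: (@rcomp_ext _ (fun p e => (size (dec (U p e)) <= K p e) ||
    ~~ (nth 0 (dec (U p e)) (K p e) == 0))).
  move=> p e; rewrite /related -/(K p e); case: leqP => le /=.
    by rewrite nth_default.
  by congr (nat_of_bool (_ != _)); exact: set_nth_default.
apply: rcomp_or; first by apply: rcomp_leq => //; exact: rcomp_size.
by apply: rcomp_neg; apply: rcomp_eq0; exact: rcomp_nth.
Qed.

Ltac rcomp_tac := repeat (cbv beta; first
  [ by apply: rcomp_var | assumption | simple apply rcomp_const
  | simple apply rcomp_and | simple apply rcomp_or | simple apply rcomp_implb
  | simple apply rcomp_neg | simple apply rcomp_leq | simple apply rcomp_eq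
  | simple apply rcomp_all | simple apply rcomp_if
  | simple apply rcomp_prefix | simple apply rcomp_tree_of
  | simple apply rcomp_related | simple apply rcomp_entry
  | simple apply rcomp_nth | simple apply rcomp_size
  | simple apply rcomp_code_nseq | simple apply rcomp_code_nil
  | simple apply rcomp_code_cons
  | simple apply rcomp_cantor | simple apply rcomp_oracle
  | simple apply rcomp_double | simple apply rcomp_half | simple apply rcomp_odd
  | simple apply rcomp_add | simple apply rcomp_succ ]).

Lemma rcomp_splits k A B C : rcomp k A -> rcomp k B -> rcomp k C ->
  rcomp k (fun p e => splits (tree_of p) (dec (A p e)) (dec (B p e)) (dec (C p e))).
Proof. by move=> hA hB hC; rewrite /splits; rcomp_tac. Qed.

Lemma rcomp_root_ok : rcomp 3 (fun p e => root_ok (tree_of p) (dec (e 0)) (e 1) (e 2)).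
Proof. rewrite /root_ok; rcomp_tac. Qed.

Lemma rcomp_step_ok k U N A B C D V :
  rcomp k U -> rcomp k N -> rcomp k A -> rcomp k B -> rcomp k C -> rcomp k D ->
  rcomp k V -> rcomp k (fun p e => step_ok (tree_of p) (dec (U p e)) (N p e)
    (A p e) (B p e) (C p e) (D p e) (V p e)).
Proof.
move=> *; rewrite /step_ok; rcomp_tac; simple apply rcomp_splits; rcomp_tac.
Qed.

Lemma rcomp_witness_tree :
  rcomp 1 (fun p e => witness_tree (tree_of p) (dec (e 0))).
Proof.
rewrite /witness_tree /is_marker /marker_ok; rcomp_tac.
- apply: (rcomp_app3 (f := fun p u n c => root_ok (tree_of p) (dec u) n c));
    rcomp_tac; exact: rcomp_root_ok.
- simple apply rcomp_step_ok; rcomp_tac.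
Qed.

Lemma computable_total (f : baire -> nat -> nat) :
  rcomp 1 (fun p e => f p (e 0)) -> computable (fun p => Some (f p)).
Proof.
by move=> [c h]; exists c => p q [<-] n; exact: (h p (fun=> n)).
Qed.

Lemma computable_search (A : baire -> nat -> nat -> bool)
    (f : baire -> nat -> nat -> nat) (F : baire -> option baire) :
  rcomp 2 (fun p e => A p (e 1) (e 0)) -> rcomp 2 (fun p e => f p (e 1) (e 0)) ->
  (forall p q, F p = Some q -> forall n, exists z,
    [/\ A p n z, forall i, i < z -> ~~ A p n i & q n = f p n z]) ->
  computable F.
Proof.
(* [Mu] looks for a zero, so it runs on the negation of [A]. *)
move=> /rcomp_neg[a ha] [c hc] hF; exists (Comp c [:: Mu a; Proj 0]).
move=> p q /hF h n; have [z [Az minz ->]] := h n.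
have ev i : eval p a [:: i; n] (~~ A p n i).
  exact: (ha p (fun j => if j is 0 then i else n)).
exists [:: z; n]; last exact: (hc p (fun j => if j is 0 then z else n)).
split; last by [].
split; first by have := ev z; rewrite Az.
by move=> i /minz nA; exists 0; have := ev i; rewrite nA.
Qed.

Definition transform (p : baire) : baire :=
  fun n => witness_tree (tree_of p) (dec n).

Lemma computable_transform : computable (fun p => Some (transform p)).
Proof. exact: (@computable_total transform) rcomp_witness_tree. Qed.

Definition paths_space (T : pred (seq nat)) : closed_space :=
  exist _ (paths T) (@paths_closed T).

Lemma closed_name_tree p (C : closed_set) : closed_name p C ->
  is_tree (tree_of p) /\ paths (tree_of p) = sval C.
Proof.
move=> [T [treeT pT TC]]; suff -> : tree_of p = T by [].
by apply/funext => s; rewrite /tree_of pT; case: (T s).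
Qed.

Lemma transform_name p : name (transform p) (paths_space (witness_tree (tree_of p))).
Proof.
exists (witness_tree (tree_of p)); split=> //; first exact: witness_tree_is_tree.
by move=> s; rewrite /transform CodeSeq.codeK.
Qed.

Lemma PK_perfect_part (A : closed_set) (T : pred (seq nat)) :
  is_tree T -> paths T = sval A ->
  exists P : closed_set, PK A P /\ sval P = perfect_part T.
Proof.
move=> treeT TA; have h := perfect_part_kernel treeT; have [[cP _] _ _] := h.
by exists (exist _ _ cP); split=> //; rewrite /PK /= -TA.
Qed.

Lemma PK_witness_dom T : dom PK (paths_space (witness_tree T)).
Proof.
have [P [kP _]] := PK_perfect_part (A := paths_space _) (@witness_tree_is_tree T) erefl.
by exists P.
Qed.

Lemma spike_path T m : paths (witness_tree T) (spike m).
Proof. by apply/paths_witness_tree => n /spike_marker. Qed.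

(** * From a list of the scattered part to the perfect kernel *)

Definition half_left (o : baire) : baire := fun n => o n.*2.
Definition half_right (o : baire) : baire := fun n => o n.*2.+1.

Lemma half_left_interleave p r : half_left (interleave p r) = p.
Proof. by apply/funext => n; rewrite /half_left /interleave odd_double doubleK. Qed.

Lemma half_right_interleave p r : half_right (interleave p r) = r.
Proof.
apply/funext => n.
by rewrite /half_right /interleave /= odd_double /= uphalf_double.
Qed.

(** In a name of a list, digit [(i, 0)] is the flag of item [i], and digit [(i, 1)] is the first
    value of its point, here the [m] of a [spike m]. *)
Definition removed (r : baire) (u : seq nat) (i : nat) : bool :=
  let m := r (Cantor.to_nat (i, 1)) in
  [&& r (Cantor.to_nat (i, 0)) == 1, entry m 0 == entry m 1 &
      prefix (dec (entry m 0)) u].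

(** Item [i] cuts only sequences longer than [i]. This keeps the test finite and the root in the
    tree, while an infinite path through a cut node is still lost eventually. *)
Definition pruned_tree (T : pred (seq nat)) (r : baire) : pred (seq nat) :=
  fun u => T u && all (fun i => ~~ removed r u i) (iota 0 (size u)).

Definition prune (o : baire) : baire :=
  fun n => pruned_tree (tree_of (half_left o)) (half_right o) (dec n).

Lemma computable_prune : computable (fun o => Some (prune o)).
Proof.
apply: computable_total.
apply: (@rcomp_ext _ (fun p e => ~~ (p (e 0).*2 == 0) &&
   all (fun i => ~~ removed (half_right p) (dec (e 0)) i) (iota 0 (size (dec (e 0)))))).
  by move=> p e; rewrite /prune /pruned_tree /tree_of CodeSeq.decodeK.
rewrite /removed /half_right; rcomp_tac.
Qed.

Lemma prefix_mkseqP (s : seq nat) (x : nat -> nat) n :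
  prefix s (mkseq x n) -> s = mkseq x (size s).
Proof.
move=> ps; have := size_prefix ps; rewrite size_mkseq => le.
move: ps; rewrite prefixE => /eqP {1}<-.
by rewrite /mkseq -map_take take_iota (minn_idPl le).
Qed.

Lemma pruned_tree_name T (r : baire) (P : closed_set) : is_tree T ->
  sval P = perfect_part T ->
  (forall m, settled_code T m <-> exists i,
     r (Cantor.to_nat (i, 0)) = 1 /\ r (Cantor.to_nat (i, 1)) = m) ->
  closed_name (fun n => pruned_tree T r (dec n)) P.
Proof.
move=> treeT PT hr; exists (pruned_tree T r); split.
- split.
    by exists [::]; rewrite /pruned_tree tree_nil.
  move=> s t st /andP[Tt /allP h]; apply/andP; split.
    exact: tree_prefix st Tt.
  apply/allP => i; rewrite mem_iota add0n => /andP[_ lt].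
  have := h i; rewrite mem_iota add0n (leq_trans lt (size_prefix st)).
  move=> /(_ isT); apply: contra => /and3P[r1 mm ms]; apply/and3P; split=> //.
  exact: prefix_trans ms st.
- by move=> s; rewrite CodeSeq.codeK.
- rewrite PT; apply/seteqP; split=> x.
    move=> hx; split=> [n|n st]; first by have /andP[] := hx n.
    have /hr[i [r0 r1]] : settled_code T (enc [:: enc (mkseq x n); enc (mkseq x n)]).
      by rewrite /settled_code !entry_code !CodeSeq.codeK.
    (* Long enough to extend the node of length [n] and to have item [i] consulted. *)
    have /andP[_ /allP/(_ i)] := hx (maxn n i.+1).
    rewrite mem_iota add0n size_mkseq leq_max leqnn orbT => /(_ isT) /negP; apply.
    rewrite /removed r0 r1 /entry !CodeSeq.codeK /= !eqxx /=.
    by apply: mkseq_prefix; exact: leq_maxl.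
  move=> [Tx nx] n; apply/andP; split; first exact: Tx.
  apply/allP => i _; apply/negP => /and3P[/eqP r0 /eqP mm /prefix_mkseqP E].
  apply: (nx (size (dec (entry (r (Cantor.to_nat (i, 1))) 0)))); rewrite -E.
  by rewrite {2}mm; apply/hr; exists i.
Qed.

Lemma wScList_witness_dom T : dom wScList (paths_space (witness_tree T)).
Proof.
have [P kP] := PK_witness_dom T.
exists (fun m => (`[< settled_code T m >], spike m)), P => //.
apply/seteqP; split=> x.
  move=> /(witness_kernel kP)[sx xE]; exists (x 0).
  by rewrite -xE; congr pair; exact/asboolP.
move=> [m [/asboolP sm <-]]; apply/(witness_kernel kP).
by [].
Qed.

(** By [witness_kernel] the listed points are the spikes of the settled codes, so their first values
    give the enumeration needed in [pruned_tree_name]. *)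
Lemma PK_le_wScList : weihrauch_le PK wScList.
Proof.
exists (fun p => Some (transform p)), (fun o => Some (prune o)); split.
- exact: computable_transform.
- exact: computable_prune.
move=> p A /closed_name_tree[treeT TA] _; set T := tree_of p in treeT TA *.
exists (transform p), (paths_space (witness_tree T)); split=> //.
- exact: transform_name.
- exact: wScList_witness_dom.
move=> r z [P kP Pz] rz; have [Q [kQ QT]] := PK_perfect_part treeT TA.
exists (prune (interleave p r)), Q; split=> //.
rewrite /prune half_left_interleave half_right_interleave -/T.
apply: pruned_tree_name => // m.
have zP i : r (Cantor.to_nat (i, 0)) = (z i).1 /\ r (Cantor.to_nat (i, 1)) = (z i).2 0.
  have [b [x [E bz xz]]] := rz i.
  have Ei j := congr1 (@^~ j) E; have /= E0 := Ei 0; have /= E1 := Ei 1.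
  by rewrite E0 E1 /interleave /= -bz -xz.
split=> [sm|[i []]].
  have : (paths (witness_tree T) `\` sval P) (spike m).
    by apply/(witness_kernel kP).
  by rewrite Pz => -[i Ei]; exists i; have [-> ->] := zP i; rewrite Ei.
have [-> ->] := zP i => b1 <-.
suff /(witness_kernel kP)[] : (paths (witness_tree T) `\` sval P) (z i).2 by [].
by rewrite Pz; exists i; move: b1; case: (z i) => -[].
Qed.

(* In a name [r] of a tree whose paths form the perfect kernel of the witness
   tree, stage [l] reveals that [spike m] is not in the kernel. *)
Definition excluded (r : baire) (m l : nat) : bool := r (enc (m :: nseq l 0)) == 0.

(* The list has one item for each pair [i] of a node and a stage [l]; it is used
   if stage [l] reveals that the node settles itself. *)
Definition item_selected (r : baire) (i : nat) : bool :=
  excluded r (enc [:: entry i 0; entry i 0]) (entry i 1).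

(** [z] codes a node and a stage revealing that the node of item [i] settles it. Such a node lies on
    the scattered path and is long enough to show digit [k]. *)
Definition item_witness (r : baire) (i k z : nat) : bool :=
  [&& prefix (dec (entry i 0)) (dec (entry z 0)), k < size (dec (entry z 0)) &
      excluded r (enc [:: entry i 0; entry z 0]) (entry z 1)].

(** Even [j] carry the flag of item [i], odd [j] its point. Only the point of a selected item needs
    a search. *)
Definition digit_ready (r : baire) (n z : nat) : bool :=
  let i := (Cantor.of_nat n).1 in let j := (Cantor.of_nat n).2 in
  odd j && item_selected r i ==> item_witness r i j./2 z.

Definition digit (r : baire) (n z : nat) : nat :=
  let i := (Cantor.of_nat n).1 in let j := (Cantor.of_nat n).2 in
  if odd j then
    if item_selected r i then nth 0 (dec (entry z 0)) j./2 else 0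
  else item_selected r i.

(** Partial, since on an arbitrary oracle a search may fail; the least witness is the one that [Mu]
    finds. *)
Definition listing (r : baire) : option baire :=
  if pselect (forall n, exists z, digit_ready r n z) is left h
  then Some (fun n => digit r n (ex_minn (h n))) else None.

Lemma computable_listing : computable (fun o => listing (half_right o)).
Proof.
have of_nat1 k F := fun h => (@rcomp_cantor_inv k F h).1.
have of_nat2 k F := fun h => (@rcomp_cantor_inv k F h).2.
apply: (@computable_search (fun o => digit_ready (half_right o))
                           (fun o => digit (half_right o))).
- rewrite /digit_ready /item_witness /item_selected /excluded /half_right.
  by rcomp_tac; (simple apply of_nat1 || simple apply of_nat2); rcomp_tac.
- rewrite /digit /item_selected /excluded /half_right.
  by rcomp_tac; (simple apply of_nat1 || simple apply of_nat2); rcomp_tac.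
- move=> o q; rewrite /listing; case: pselect => // h [<-] n.
  case: ex_minnP => z rz min; exists z; split=> // i; apply: contraTN => /min.
  by rewrite -leqNgt.
Qed.

Lemma wScList_le_PK : weihrauch_le wScList PK.
Proof.
exists (fun p => Some (transform p)), (fun o => listing (half_right o)); split.
- exact: computable_transform.
- exact: computable_listing.
move=> p A /closed_name_tree[treeT TA] _; set T := tree_of p in treeT TA *.
exists (transform p), (paths_space (witness_tree T)); split=> //.
- exact: transform_name.
- exact: PK_witness_dom.
move=> r P kP [R [treeR rR RP]]; rewrite half_right_interleave.
(* [spike m] is outside the kernel iff its initial segment of some length [l.+1] is outside [R];
   length 0 cannot occur, as a tree contains the root. *)
have exclP m : settled_code T m <-> exists l, excluded r m l.
  have -> : settled_code T m <-> ~ sval P (spike m).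
    split=> [sm|nP].
      by have [|_] := (witness_kernel kP (spike m)).2.
    have [//|//] := (witness_kernel kP (spike m)).1.
    by split; first exact: spike_path.
  have mk l : mkseq (spike m) l.+1 = m :: nseq l 0.
    apply: (@eq_from_nth _ 0); first by rewrite size_mkseq /= size_nseq.
    rewrite size_mkseq => -[|i] lt; rewrite nth_mkseq //=.
    by rewrite nth_nseq if_same.
  rewrite -RP; split=> [/existsNP[[|l] nR]|[l]].
  - by case: nR; exact: tree_nil.
  - by exists l; move: nR; rewrite /excluded rR mk; case: (R _).
  - by rewrite /excluded rR -mk => Rl /(_ l.+1); move: Rl; case: (R _).
have selP i : item_selected r i -> settles T (dec (entry i 0)) (dec (entry i 0)).
  move=> sel; have : settled_code T (enc [:: entry i 0; entry i 0]).
    by apply/exclP; exists (entry i 1).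
  by rewrite /settled_code !entry_code.
have ready n : exists z, digit_ready r n z.
  rewrite /digit_ready; case: (Cantor.of_nat n) => i j /=.
  have [/andP[_ sel]|] := boolP (odd j && item_selected r i); last by exists 0.
  have [x [Tx _ hx]] := settled_scattered treeT (selP i sel).
  set s := dec (entry i 0) in hx; pose t := mkseq x (size s + j./2.+1).
  have st : prefix s t.
    by rewrite (hx _ (prefix_refl _)).1 ?mkseq_prefix ?leq_addr //; exact: selP.
  have : settled_code T (enc [:: entry i 0; enc t]).
    by rewrite /settled_code !entry_code !CodeSeq.codeK; apply/hx; rewrite // size_mkseq.
  move=> /exclP[l hl]; exists (enc [:: enc t; l]).
  rewrite /item_witness !entry_code /= !CodeSeq.codeK st hl.
  by rewrite size_mkseq addnS ltnS leq_addl.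
rewrite /listing; case: pselect => // h.
set q : baire := fun n => _.
pose item i : bool * baire :=
  (item_selected r i, fun k => q (Cantor.to_nat (i, k.*2.+1))).
have qsel i j : ~~ odd j -> q (Cantor.to_nat (i, j)) = item_selected r i.
  by move=> ev; rewrite /q /digit Cantor.cancel_of_to /= (negbTE ev).
(* Whichever node a search returns, it lies on [x], so the digits from separate searches fit
   together. *)
have itemP i (x : baire) : item_selected r i ->
    (forall t, prefix (dec (entry i 0)) t ->
      (settles T (dec (entry i 0)) t <-> t = mkseq x (size t))) ->
    (item i).2 = x.
  move=> sel hx; apply/funext => k.
  rewrite -[LHS]/(q (Cantor.to_nat (i, k.*2.+1))) /q /digit.
  case: ex_minnP => z; rewrite /digit_ready Cantor.cancel_of_to /=.
  rewrite odd_double sel /= uphalf_double => /and3P[st ltk ex] _.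
  have : settles T (dec (entry i 0)) (dec (entry z 0)).
    have : settled_code T (enc [:: entry i 0; entry z 0]).
      by apply/exclP; exists (entry z 1).
    by rewrite /settled_code !entry_code.
  by move=> /(hx _ st) ->; rewrite nth_mkseq.
exists q, item; split=> //.
  move=> i; exists (fun n => q (Cantor.to_nat (i, n.*2))), (item i).2; split=> //.
    apply/funext => n; have := odd_double_half n; rewrite /interleave.
    by case: (odd n) => /= nE; rewrite -[in LHS]nE.
  exact: qsel.
have [Q [kQ QT]] := PK_perfect_part treeT TA; exists Q => //.
rewrite QT -TA; apply/seteqP; split=> x.
  move=> [Tx nx]; have [s ss hs] := scattered_settled treeT Tx nx.
  have : settled_code T (enc [:: enc s; enc s]).
    by rewrite /settled_code !entry_code !CodeSeq.codeK.
  move=> /exclP[l hl]; exists (enc [:: enc s; l]).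
  have sel : item_selected r (enc [:: enc s; l]).
    by rewrite /item_selected /entry CodeSeq.codeK.
  rewrite -(itemP _ x sel); last by rewrite /entry !CodeSeq.codeK.
  by rewrite /item sel.
move=> [i [sel <-]]; have [y [Ty ny hy]] := settled_scattered treeT (selP i sel).
by have /= -> := itemP i y sel hy.
Qed.

Theorem theorem4p25 : weihrauch_equiv wScList PK.
Proof. by split; [exact: wScList_le_PK|exact: PK_le_wScList]. Qed.
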